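(* A $2\times 2$ net in $\mathbb{R}^d$ is deformable if and only if at least one of the following conditions holds: (i) the four faces split into two pairs (each pair consisting of two faces with a common edge) such that the two faces of each pair are affine symmetric with respect to their common edge; (ii) each pair of faces with a common edge has equal opposite ratios with respect to that edge.
   Context: An $m\times n$ net is a collection of $(m+1)(n+1)$ points $P_{ij}\in\mathbb{R}^d$, $0\le i\le m$, $0\le j\le n$ (not necessarily distinct), such that for all $0\le i<m$, $0\le j<n$ the points $P_{ij},P_{i+1,j},P_{i+1,j+1},P_{i,j+1}$ are consecutive vertices of a convex (planar, non-degenerate) quadrilateral. These quadrilaterals are the faces and their sides are the edges. Faces and edges are labeled by the indices of their vertices: those with different labels are viewed as distinct even if they coincide as subsets of $\mathbb{R}^d$, and a common edge of two faces must have common labels with both. Faces or edges of two $m\times n$ nets spanned by points with the same indices are called corresponding. Two $m\times n$ nets are parallel (Combescure transformations of each other) if their corresponding edges are parallel. They are congruent if there is an isometry of $\mathbb{R}^d$ taking each point of the first net to the point of the second net with the same indices. An $m\times n$ net is deformable if it is contained in a continuous family of non-congruent parallel $m\times n$ nets with the same areas of corresponding faces. Two quadrilaterals in $\mathbb{R}^d$ with a common side are affine symmetric with respect to the common side if there is an affine map taking the first quadrilateral to the second one and keeping the points of the common side fixed (labels are ignored). For a convex quadrilateral $ABCD$ with diagonals meeting at $Q$, the opposite ratio of $ABCD$ with respect to the side $AB$ is $\mathrm{Area}(AQB)/\mathrm{Area}(CQD)$. *)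

(* Defs.v *)
From mathcomp Require Import all_boot all_order all_algebra.
From mathcomp Require Import all_classical all_reals all_analysis.

Set Implicit Arguments.
Unset Strict Implicit.
Unset Printing Implicit Defensive.

Import Order.TTheory GRing.Theory Num.Theory.
Import numFieldNormedType.Exports.

Local Open Scope classical_set_scope.
Local Open Scope ring_scope.

Section Geometry.
Variables (R : realType) (d : nat).
Local Notation point := 'rV[R]_d.
Implicit Types A B C D E F Q u v x y : point.

Definition dotv u v : R := \sum_(k < d) u 0 k * v 0 k.

(* The norm the library puts on 'rV[R]_d is the sup norm (it induces the usual
   topology); distances and areas below are Euclidean. *)
Definition edist x y : R := Num.sqrt (dotv (x - y) (x - y)).

Definition isometry (f : point -> point) : Prop :=
  forall x y, edist (f x) (f y) = edist x y.

Definition affine_map (f : point -> point) : Prop :=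
  exists (M : 'M[R]_d) (b : point), forall x, f x = x *m M + b.

Definition collinear A B C : Prop := (\rank (col_mx (B - A) (C - A)) <= 1)%N.

Definition seg A B : set point :=
  [set x | exists2 t : R, 0 <= t <= 1 & x = (1 - t) *: A + t *: B].

Definition quad A B C D : set point :=
  [set x | exists a b c e : R,
    [/\ 0 <= a, 0 <= b, 0 <= c, 0 <= e & a + b + c + e = 1] /\
    x = a *: A + b *: B + c *: C + e *: D].

(* A, B, C, D are consecutive vertices of a convex quadrilateral: no three of
   them are collinear and the diagonals AC and BD meet (hence the four points
   are coplanar and all angles are less than pi). *)
Definition convex_quad A B C D : Prop :=
  [/\ ~ collinear A B C, ~ collinear B C D, ~ collinear C D A,
      ~ collinear D A B & seg A C `&` seg B D !=set0].

(* Half the square root of the Gram determinant of B - A and C - A. *)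
Definition tri_area A B C : R :=
  Num.sqrt (dotv (B - A) (B - A) * dotv (C - A) (C - A)
            - dotv (B - A) (C - A) ^+ 2) / 2.

Definition quad_area A B C D : R := tri_area A B C + tri_area A C D.

(* The value of xget is junk (namely A) if the diagonals do not meet; for a
   convex quadrilateral they meet in exactly one point. *)
Definition diag_point A B C D : point := xget A (seg A C `&` seg B D).

(* Opposite ratio of ABCD with respect to the side AB. *)
Definition opposite_ratio A B C D : R :=
  let Q := diag_point A B C D in tri_area A Q B / tri_area C Q D.

(* The two predicates below concern the quadrilaterals ABCD and ABEF with
   the common side AB. *)

Definition affine_symmetric A B C D E F : Prop :=
  exists2 f : point -> point, affine_map f &
    (forall x, seg A B x -> f x = x) /\ f @` quad A B C D = quad A B E F.

Definition same_opposite_ratio A B C D E F : Prop :=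
  opposite_ratio A B C D = opposite_ratio A B E F.

Definition parallel u v : Prop := exists2 k : R, k != 0 & v = k *: u.

End Geometry.

(* The two ends of the i-th index step: i and i.+1 as elements of 'I_n.+1. *)
Definition lo n (i : 'I_n) : 'I_n.+1 := widen_ord (leqnSn n) i.
Definition hi n (i : 'I_n) : 'I_n.+1 := lift ord0 i.

Section Nets.
Variables (R : realType) (d m n : nat).
Local Notation point := 'rV[R]_d.
Local Notation points := ('I_m.+1 -> 'I_n.+1 -> point).
Implicit Types P : points.

Definition net P : Prop := forall (i : 'I_m) (j : 'I_n),
  convex_quad (P (lo i) (lo j)) (P (hi i) (lo j))
              (P (hi i) (hi j)) (P (lo i) (hi j)).

Definition face_area P (i : 'I_m) (j : 'I_n) : R :=
  quad_area (P (lo i) (lo j)) (P (hi i) (lo j))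
            (P (hi i) (hi j)) (P (lo i) (hi j)).

Definition parallel_nets P (P' : points) : Prop :=
  (forall (i : 'I_m) (j : 'I_n.+1),
     parallel (P (hi i) j - P (lo i) j) (P' (hi i) j - P' (lo i) j)) /\
  (forall (i : 'I_m.+1) (j : 'I_n),
     parallel (P i (hi j) - P i (lo j)) (P' i (hi j) - P' i (lo j))).

Definition congruent_nets P (P' : points) : Prop :=
  exists2 f : point -> point, isometry f & forall i j, f (P i j) = P' i j.

(* The family is parametrized by a nondegenerate segment [a, b] and its members
   are pairwise non-congruent; P is the member with parameter t0. *)
Definition deformable P : Prop :=
  exists (a b t0 : R) (N : R -> points),
    [/\ a < b, a <= t0 <= b & forall i j, N t0 i j = P i j] /\
    [/\ forall i j, {within `[a, b], continuous (fun t => N t i j)},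
        forall t, a <= t <= b ->
          [/\ net (N t), parallel_nets P (N t) &
              forall i j, face_area (N t) i j = face_area P i j]
      & forall s t, a <= s <= b -> a <= t <= b -> s != t ->
          ~ congruent_nets (N s) (N t)].

End Nets.

Section TwoByTwo.
Variables (R : realType) (d : nat).
Local Notation point := 'rV[R]_d.
Implicit Types P : 'I_3 -> 'I_3 -> point.

Definition transposed P : 'I_3 -> 'I_3 -> point := fun i j => P j i.

(* S holds of the faces with indices (0, j) and (1, j), whose common edge joins
   P_(1, j) and P_(1, j+1). Applied to [transposed P], it is about the faces
   (j, 0) and (j, 1) of P. *)
Definition adjacent_faces
    (S : point -> point -> point -> point -> point -> point -> Prop)
    P (j : 'I_2) : Prop :=
  let P0 := P ord0 in let P1 := P (inord 1) in let P2 := P ord_max in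
  S (P1 (lo j)) (P1 (hi j)) (P0 (hi j)) (P0 (lo j)) (P2 (hi j)) (P2 (lo j)).

Definition affine_symmetric_pairs P : Prop :=
  (forall j : 'I_2, adjacent_faces (@affine_symmetric R d) P j) \/
  (forall i : 'I_2, adjacent_faces (@affine_symmetric R d) (transposed P) i).

Definition equal_opposite_ratios P : Prop :=
  (forall j : 'I_2, adjacent_faces (@same_opposite_ratio R d) P j) /\
  (forall i : 'I_2, adjacent_faces (@same_opposite_ratio R d) (transposed P) i).

End TwoByTwo.

(* Main.v *)
(* Write a face with vertices O, A, C, B (O the centre of the net) as
   C - O = m (p (A - O) + r (B - O)) with m = (p r + 1) / (p + r); then 1 / p ^ 2 and
   1 / r ^ 2 are its opposite ratios with respect to OA and OB. A parallel face whose
   edges OA and OB are scaled by x and y has the same area iff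
   (r x + p y) ^ 2 - (x - y) ^ 2 = (p + r) ^ 2, a hyperbola parametrized by
   x = cosh s + p sinh s, y = cosh s - r sinh s. A deformation is therefore an
   infinite family of points (x1, x2, x3, x4) on a cycle of four such hyperbolas.
   Along the hyperbola of the first face the lengths x4 and x3 involve square roots
   which are independent over the field of rational functions of exp (2 s) unless
   one of the two edges x1, x2 has equal opposite ratios on its two sides. Hence
   two opposite edges do; gluing the hyperbolas along these leaves two conics
   for (x1, x3) (say), which either are lines x1 = x3, giving condition (i), or
   coincide, giving condition (ii). Conversely, under (i) or (ii) the cycle closes up
   for all x1 near 1. *)
Require Import Defs.
From mathcomp Require Import all_boot all_order all_algebra.
From mathcomp Require Import all_classical all_reals all_analysis.
From mathcomp Require Import ring lra zify.

Set Implicit Arguments.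
Unset Strict Implicit.
Unset Printing Implicit Defensive.

Import Order.TTheory GRing.Theory Num.Theory.
Import numFieldNormedType.Exports.

Local Open Scope classical_set_scope.
Local Open Scope ring_scope.

(** * Square roots of polynomials *)

Section SquareFree.
Variable F : numFieldType.
Implicit Types A B U V W q : {poly F}.

(** The independence argument uses neither a function field nor the exponential: a deformation is
    sampled at infinitely many parameters, z is the square of c + h at each sample (c and h playing
    cosh and sinh), and a polynomial relation in z that holds at all samples holds identically. A
    square root is then a sequence whose squares are the values of a quadratic, and two of them are
    independent once the quadratics are squarefree, nonconstant and not proportional. The obstacle
    is that these quadratics degenerate not only at a matched edge but also where a leading
    coefficient p^2 - 1 or r^2 - 1 of a conic vanishes. There the conic is linear in the unknown
    length, the length is a rational function of z, and its pole has to do the work of the square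
    root. One mixed case escapes this and is settled by reversing the cycle. The parameters p and r
    are chosen so that the area condition is a difference of two squares: every face then carries
    the same curve c^2 - h^2 = 1, and gluing two faces along a matched edge is linear. *)

Definition squarefree A := forall q, q ^+ 2 %| A -> size q = 1%N.

Lemma squarefree1 : squarefree 1.
Proof.
move=> q q2; apply/eqP; rewrite -dvdp1; apply: dvdp_trans q2.
exact: dvdp_mulr.
Qed.

(** A square factor of degree one has a root x, which is then a double root, and the discriminant is
    A'(x)^2 - 4 a A(x). The coefficient [a] may be 0, as happens for [B] below when [r1] = 1. *)
Lemma squarefree_quadratic (a b c : F) :
  b ^+ 2 - 4 * a * c != 0 -> squarefree (a *: 'X^2 + b *: 'X + c%:P).
Proof.
move=> disc q /dvdpP[h eq_h]; set A := LHS in eq_h.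
have A0 : A != 0.
  apply: contraNneq disc => A0.
  have : A`_0 = 0 /\ A`_1 = 0 /\ A`_2 = 0 by rewrite A0 !coef0.
  rewrite /A !coefD !coefZ !coefXn !coefX !coefC /=.
  by rewrite !mulr0 !mulr1 !addr0 !add0r => -[-> [-> ->]]; rewrite expr0n !mulr0 subrr.
have h0 : h != 0 by apply: contraNneq A0 => h0; rewrite eq_h h0 mul0r.
have q0 : q != 0 by apply: contraNneq A0 => q0; rewrite eq_h q0 expr0n mulr0.
have sA : (size A <= 3)%N.
  rewrite /A; apply: leq_trans (size_polyD _ _) _; rewrite geq_max; apply/andP; split.
    apply: leq_trans (size_polyD _ _) _; rewrite geq_max; apply/andP; split.
      by apply: leq_trans (size_scale_leq _ _) _; rewrite size_polyXn.
    by apply: leq_trans (size_scale_leq _ _) _; rewrite size_polyX.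
  by apply: leq_trans (size_polyC_leq1 _) _.
have sq0 : (0 < size q)%N by rewrite size_poly_gt0.
have sh0 : (0 < size h)%N by rewrite size_poly_gt0.
have [//|sq1] := eqVneq (size q) 1%N.
have sq2 : size q = 2.
  have sA2 : (2 * (size q) <= size A + 1)%N.
    rewrite eq_h size_mul ?expf_neq0 // expr2 size_mul //.
    by case: (size q) (size h) sq0 sh0 => [//|n] [//|k] _ _; lia.
  by lia.
have [x /rootP qx] := poly2_root sq2.
have A_x : A.[x] = 0 by rewrite eq_h hornerM expr2 hornerM qx !mulr0.
have A'x : (A^`()).[x] = 0.
  by rewrite eq_h expr2 !derivM !(hornerD, hornerM) qx !(mulr0, mul0r, addr0).
case/eqP: disc.
move: A_x A'x; rewrite /A !derivD !derivZ derivXn derivX derivC !hornerE => A_x A'x.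
have D0 : b + 2 * a * x = 0 by rewrite -[RHS]A'x /=; ring.
have A0x : a * x ^+ 2 + b * x + c = 0 by rewrite -[RHS]A_x /=; ring.
transitivity ((b + 2 * a * x) ^+ 2 - 4 * a * (a * x ^+ 2 + b * x + c)); first by ring.
by rewrite D0 A0x mulr0 subr0 expr0n.
Qed.

(** Cancelling the gcd of [V] and [W] leaves coprime v and w with v^2 dividing [A] and w^2 dividing
    [B], so both are constants. *)
Lemma squarefree_ratio A B V W :
  squarefree A -> squarefree B -> A * W ^+ 2 = B * V ^+ 2 -> V != 0 -> A %= B.
Proof.
move=> sfA sfB AB V0.
pose g := gcdp V W.
have g0 : g != 0 by rewrite gcdp_eq0 negb_and V0.
have [V1 W1] : V %/ g * g = V /\ W %/ g * g = W.
  by rewrite !divpK ?dvdp_gcdl ?dvdp_gcdr.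
set v := V %/ g in V1; set w := W %/ g in W1.
have cvw : coprimep v w by apply: coprimep_div_gcd; rewrite V0.
have {}AB : A * w ^+ 2 = B * v ^+ 2.
  apply: (mulIf (expf_neq0 2 g0)).
  by rewrite -[LHS]mulrA -[RHS]mulrA -!exprMn V1 W1.
have c2 : coprimep (v ^+ 2) (w ^+ 2) by rewrite coprimep_expl ?coprimep_expr.
have sv : size v = 1%N.
  by apply: sfA; rewrite -(Gauss_dvdpl _ c2) AB dvdp_mull.
have sw : size w = 1%N.
  by apply: sfB; rewrite coprimep_sym in c2; rewrite -(Gauss_dvdpl _ c2) -AB dvdp_mull.
have [[c c0 Ec] [e e0 Ee]] : (exists2 c, c != 0 & v = c%:P) /\
  (exists2 c, c != 0 & w = c%:P).
  by split; apply/size_poly1P/eqP.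
apply/eqpP; exists (e ^+ 2, c ^+ 2); rewrite ?expf_neq0 //=.
move: AB; rewrite Ec Ee -!polyC_exp !(mulrC _ (polyC _)) => AB.
by rewrite -!mul_polyC.
Qed.

Lemma poly_eq0_injective (z : nat -> F) (p : {poly F}) :
  injective z -> (forall n, p.[z n] = 0) -> p = 0.
Proof.
move=> zinj pz; apply/eqP; apply: contraT => p0.
have rs : all (root p) (map z (iota 0 (size p))).
  by apply/allP => _ /mapP[n _ ->]; apply/rootP.
have us : uniq (map z (iota 0 (size p))) by rewrite map_inj_uniq ?iota_uniq.
by have := max_poly_roots p0 rs us; rewrite size_map size_iota ltnn.
Qed.

Section SquareRoots.
Variables (z s t : nat -> F) (A B : {poly F}).
Hypotheses (zinj : injective z) (sfA : squarefree A) (sfB : squarefree B).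
Hypotheses (A1 : size A != 1%N) (B1 : size B != 1%N).
Hypotheses (tA : forall n, t n ^+ 2 = A.[z n]) (sB : forall n, s n ^+ 2 = B.[z n]).

Lemma sqrt_free U V : (forall n, U.[z n] + V.[z n] * s n = 0) -> U = 0 /\ V = 0.
Proof.
move=> UV.
have E : 1 * U ^+ 2 = B * V ^+ 2.
  rewrite mul1r; apply/eqP; rewrite -subr_eq0; apply/eqP.
  apply: (poly_eq0_injective zinj) => n.
  have Un : U.[z n] = - (V.[z n] * s n) by apply/eqP; rewrite -addr_eq0 UV.
  by rewrite !(hornerD, hornerN, hornerM, horner_exp) -sB Un; ring.
have V0 : V = 0.
  apply: contraNeq B1 => V0.
  have := squarefree_ratio squarefree1 sfB E V0 => /eqp_size.
  by rewrite size_poly1 => <-.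
by split=> //; move/eqP: E; rewrite V0 mul1r expr0n mulr0 expf_eq0 => /eqP.
Qed.

(* s, t and s * t are linearly independent over the rational functions of z: with
   P + Q s = 0 obtained by eliminating t, the equations P = Q = 0 give
   (k ^ 2 A - V ^ 2) (A W ^ 2 - B V ^ 2) = 0. *)
Lemma two_sqrt_free (k : F) U V W : k != 0 -> ~~ (A %= B) ->
  ~ forall n, U.[z n] + V.[z n] * s n + W.[z n] * t n + k * s n * t n = 0.
Proof.
move=> k0 nAB H.
have [P0 Q0] : U ^+ 2 + V ^+ 2 * B - A * W ^+ 2 - (k ^+ 2)%:P * A * B = 0 /\
    2%:P * (U * V - k%:P * A * W) = 0.
  apply: sqrt_free => n; rewrite !(hornerD, hornerN, hornerM, hornerC, horner_exp) -sB
    -tA.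
  transitivity ((U.[z n] + V.[z n] * s n + W.[z n] * t n + k * s n * t n) *
    (U.[z n] + V.[z n] * s n - (W.[z n] * t n + k * s n * t n))); last by rewrite H mul0r.
  by ring.
have {}Q0 : U * V - k%:P * A * W = 0.
  by apply: (mulfI (_ : 2%:P != 0)); rewrite ?polyC_eq0 ?pnatr_eq0 // mulr0.
have /eqP : ((k ^+ 2)%:P * A - V ^+ 2) * (A * W ^+ 2 - B * V ^+ 2) = 0.
  transitivity (V ^+ 2 * (U ^+ 2 + V ^+ 2 * B - A * W ^+ 2 - (k ^+ 2)%:P * A * B) -
      (U * V - k%:P * A * W) * (U * V + k%:P * A * W)).
    by rewrite polyC_exp; ring.
  by rewrite P0 Q0 mulr0 mul0r subr0.
have kP : k%:P != 0 :> {poly F} by rewrite polyC_eq0.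
have nA : ~~ (1 %= A).
  by apply: contra A1 => /eqp_size; rewrite size_poly1 => <-.
(* The first factor would make [A] a constant times a square. The second ties [A] to [B] unless V =
   0; then W = 0 as well, and U^2 = k^2 A B ties them again. *)
rewrite mulf_eq0 !subr_eq0 => /orP[/eqP kA|/eqP AB].
  case/negP: nA; apply: (squarefree_ratio squarefree1 sfA (V := k%:P) (W := V)) => //.
  by rewrite mul1r -kA polyC_exp mulrC.
have [V0|V0] := eqVneq V 0; last by case/negP: nAB; apply: squarefree_ratio AB V0.
have A0 : A != 0.
  apply/eqP => A0; have := @sfA 'X; rewrite A0 dvdp0 size_polyX.
  by move=> /(_ isT).
have W0 : W = 0.
  by apply/eqP; move/eqP: AB; rewrite V0 expr0n mulr0 mulf_eq0 (negPf A0) expf_eq0.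
case/negP: nAB; apply: (squarefree_ratio sfA sfB (V := k%:P * A) (W := U)).
  move/eqP: P0; rewrite V0 W0 !(expr0n, mulr0, mul0r, addr0, subr0) subr_eq0 => /eqP ->.
  by rewrite polyC_exp; ring.
by rewrite mulf_neq0.
Qed.
End SquareRoots.
End SquareFree.

(** * Cycles of hyperbolas *)

Section Curves.
Variable R : realFieldType.
Implicit Types p r x y : R.

Definition conic p r x y := (r * x + p * y) ^+ 2 - (x - y) ^+ 2 = (p + r) ^+ 2.

(** The last two inequalities are half the partial derivatives in y and x of the quadratic form in
    [conicE], so they select one root when either variable is given. Geometrically, they keep the
    factors of the two outer edges positive. *)
Definition admissible p r x y :=
  [/\ 0 < x, 0 < y, 0 < (p * r + 1) * x + (p ^+ 2 - 1) * y,
      0 < (r ^+ 2 - 1) * x + (p * r + 1) * y & conic p r x y].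

Lemma admissibleC p r x y : admissible p r x y -> admissible r p y x.
Proof.
case=> x0 y0 s0 t0 C; split=> //; try by lra.
by rewrite /conic (addrC r) -C; ring.
Qed.

Lemma conicE p r x y : conic p r x y ->
  (r ^+ 2 - 1) * x ^+ 2 + 2 * (p * r + 1) * x * y + (p ^+ 2 - 1) * y ^+ 2 =
  (p + r) ^+ 2.
Proof. by move=> <-; ring. Qed.

Lemma conic_inj p r x y y' : conic p r x y -> conic p r x y' ->
  0 < (p * r + 1) * x + (p ^+ 2 - 1) * y ->
  0 < (p * r + 1) * x + (p ^+ 2 - 1) * y' -> y = y'.
Proof.
move=> C C' s0 s0'; have E : (y - y') * (((p * r + 1) * x + (p ^+ 2 - 1) * y) +
    ((p * r + 1) * x + (p ^+ 2 - 1) * y')) = 0.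
  transitivity (((r * x + p * y) ^+ 2 - (x - y) ^+ 2) -
    ((r * x + p * y') ^+ 2 - (x - y') ^+ 2)); first by ring.
  by rewrite C C' subrr.
move/eqP: E; rewrite mulf_eq0 (gt_eqF (addr_gt0 s0 s0')) orbF subr_eq0.
by move/eqP.
Qed.

Lemma admissible_inj p r x y y' :
  admissible p r x y -> admissible p r x y' -> y = y'.
Proof. by case=> _ _ s0 _ C [_ _ s0' _ C']; exact: conic_inj C C' s0 s0'. Qed.

Lemma admissible_injl p r x x' y :
  admissible p r x y -> admissible p r x' y -> x = x'.
Proof. by move=> /admissibleC h /admissibleC h'; exact: admissible_inj h h'. Qed.

Lemma quadratic_size_neq1 (a b c : R) :
  b ^+ 2 - 4 * a * c != 0 -> size (a *: 'X^2 + b *: 'X + c%:P) != 1%N.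
Proof.
apply: contraNneq => /eqP/size_poly1P[e _ E].
have : (e%:P)`_1 = 0 /\ (e%:P)`_2 = 0 by rewrite !coefC.
rewrite -E !coefD !coefZ !coefXn !coefX !coefC /=.
by rewrite !mulr0 !mulr1 !addr0 !add0r => -[-> ->]; rewrite expr0n !mulr0 mul0r subrr.
Qed.

(** The equation of [conicE] after both lengths are multiplied by 2 e^tau, with z = e^(2 tau); this
    makes the data polynomial in z. *)
Definition scaled_conic p r x y z :=
  (r ^+ 2 - 1) * x ^+ 2 + 2 * (p * r + 1) * x * y + (p ^+ 2 - 1) * y ^+ 2 =
    4 * z * (p + r) ^+ 2.

(** * Two neighbouring edges that are both unmatched *)

Section Adjacent.
Variables (p1 r1 p2 r2 p3 r3 p4 r4 : R) (z x3 x4 : nat -> R).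
Hypotheses (p1_gt0 : 0 < p1) (r1_gt0 : 0 < r1) (p2_gt0 : 0 < p2) (r2_gt0 : 0 < r2).
Hypotheses (p3_gt0 : 0 < p3) (r3_gt0 : 0 < r3) (p4_gt0 : 0 < p4) (r4_gt0 : 0 < r4).
Hypotheses (zinj : injective z).
Hypotheses (bad1 : r4 != p1) (bad2 : r1 != p2).

(* X and Y (evaluated at z), x3 and x4 stand for the factors x1, x2, x3, x4 multiplied
   by 2 e^tau, where z = e^(2 tau), x1 = cosh tau + p1 sinh tau and
   x2 = cosh tau - r1 sinh tau. *)
Let X : {poly R} := (1 + p1)%:P * 'X + (1 - p1)%:P.
Let Y : {poly R} := (1 - r1)%:P * 'X + (1 + r1)%:P.
Let c1 := r4 ^+ 2 - 1.
Let b2 := p2 ^+ 2 - 1.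
(** Up to the factors (p4 + r4)^2 and (p2 + r2)^2, [A] = X^2 + 4 c1 z and [B] = Y^2 + 4 b2 z are the
    quarter discriminants of [F4] as a quadratic in x4 and of [F2] as a quadratic in x3; [t] and [s]
    are the matching square roots. *)
Let A := (1 + p1) ^+ 2 *: 'X^2 + (2 * (1 - p1 ^+ 2 + 2 * c1)) *: 'X + ((1 - p1) ^+ 2)%:P.
Let B := (1 - r1) ^+ 2 *: 'X^2 + (2 * (1 - r1 ^+ 2 + 2 * b2)) *: 'X + ((1 + r1) ^+ 2)%:P.

Let s n := ((p2 * r2 + 1) * Y.[z n] + b2 * x3 n) / (p2 + r2).
Let t n := ((p4 * r4 + 1) * X.[z n] + c1 * x4 n) / (p4 + r4).
Hypotheses (F2 : forall n, scaled_conic p2 r2 Y.[z n] (x3 n) (z n)).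
Hypotheses (F3 : forall n, scaled_conic p3 r3 (x3 n) (x4 n) (z n)).
Hypotheses (F4 : forall n, scaled_conic p4 r4 (x4 n) X.[z n] (z n)).

Let hE := (hornerD, hornerN, hornerM, hornerC, horner_exp, hornerX, hornerZ, hornerXn).

Let sB n : s n ^+ 2 = B.[z n].
Proof.
have D0 : p2 + r2 != 0 by rewrite gt_eqF ?addr_gt0.
have -> : B.[z n] = Y.[z n] ^+ 2 + 4 * b2 * z n by rewrite /B /Y !hE; ring.
apply: (mulfI (expf_neq0 2 D0)).
transitivity (((p2 * r2 + 1) * Y.[z n] + b2 * x3 n) ^+ 2).
  by rewrite /s; field.
transitivity (b2 * ((r2 ^+ 2 - 1) * Y.[z n] ^+ 2 +
  2 * (p2 * r2 + 1) * Y.[z n] * x3 n + (p2 ^+ 2 - 1) * x3 n ^+ 2) +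
  (p2 + r2) ^+ 2 * Y.[z n] ^+ 2).
  by rewrite /b2; ring.
by rewrite F2; ring.
Qed.

Let tA n : t n ^+ 2 = A.[z n].
Proof.
have D0 : p4 + r4 != 0 by rewrite gt_eqF ?addr_gt0.
have -> : A.[z n] = X.[z n] ^+ 2 + 4 * c1 * z n by rewrite /A /X !hE; ring.
apply: (mulfI (expf_neq0 2 D0)).
transitivity (((p4 * r4 + 1) * X.[z n] + c1 * x4 n) ^+ 2).
  by rewrite /t; field.
transitivity (c1 * ((r4 ^+ 2 - 1) * x4 n ^+ 2 + 2 * (p4 * r4 + 1) * x4 n * X.[z n] +
  (p4 ^+ 2 - 1) * X.[z n] ^+ 2) + (p4 + r4) ^+ 2 * X.[z n] ^+ 2).
  by rewrite /c1; ring.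
by rewrite F4; ring.
Qed.

Let sqr_neq1 p : 0 < p -> p != 1 -> p ^+ 2 - 1 != 0.
Proof.
move=> p0 p1'; rewrite subr_eq0 sqrf_eq1 negb_or p1' /= gt_eqF //.
by apply: lt_trans p0; rewrite oppr_lt0.
Qed.

(** The discriminant vanishes at r4 = p1, where [A] is the square of (1 + p1) z - (1 - p1), and at
    r4 = 1, where it is the square of [X]. *)
Let discA : r4 != 1 -> (2 * (1 - p1 ^+ 2 + 2 * c1)) ^+ 2 -
  4 * (1 + p1) ^+ 2 * (1 - p1) ^+ 2 != 0.
Proof.
move=> r41; have -> : (2 * (1 - p1 ^+ 2 + 2 * c1)) ^+ 2 -
  4 * (1 + p1) ^+ 2 * (1 - p1) ^+ 2 = 16 * (r4 ^+ 2 - 1) *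
  ((r4 - p1) * (r4 + p1)) by rewrite /c1; ring.
by rewrite !mulf_neq0 ?pnatr_eq0 ?sqr_neq1 ?subr_eq0 // gt_eqF ?addr_gt0.
Qed.

Let discB : p2 != 1 -> (2 * (1 - r1 ^+ 2 + 2 * b2)) ^+ 2 -
  4 * (1 - r1) ^+ 2 * (1 + r1) ^+ 2 != 0.
Proof.
move=> p21; have -> : (2 * (1 - r1 ^+ 2 + 2 * b2)) ^+ 2 -
  4 * (1 - r1) ^+ 2 * (1 + r1) ^+ 2 = 16 * (p2 ^+ 2 - 1) *
  ((p2 - r1) * (p2 + r1)) by rewrite /b2; ring.
have pr : p2 - r1 != 0 by rewrite subr_eq0 eq_sym.
by rewrite !mulf_neq0 ?pnatr_eq0 ?sqr_neq1 // gt_eqF ?addr_gt0.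
Qed.

(** Comparing the outer coefficients of proportional quadratics would equate ((1 + p1) (1 + r1))^2
    with ((1 - p1) (1 - r1))^2, but the former is larger. *)
Let nAB : ~~ (A %= B).
Proof.
apply/negP => /eqpP[[e f] /= /andP[e0 f0] E].
have : (e *: A)`_2 = (f *: B)`_2 /\ (e *: A)`_0 = (f *: B)`_0 by rewrite E.
rewrite /A /B !(coefZ, coefD, coefXn, coefX, coefC) /= !(mulr0, mulr1, addr0, add0r)
  => -[E2 E0].
have : e * f * ((1 + p1) ^+ 2 * (1 + r1) ^+ 2 - (1 - p1) ^+ 2 * (1 - r1) ^+ 2) = 0.
  transitivity ((e * (1 + p1) ^+ 2) * (f * (1 + r1) ^+ 2) -
    (e * (1 - p1) ^+ 2) * (f * (1 - r1) ^+ 2)); first by ring.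
  by rewrite E2 E0; ring.
apply/eqP; rewrite !mulf_neq0 //.
have -> : (1 + p1) ^+ 2 * (1 + r1) ^+ 2 - (1 - p1) ^+ 2 * (1 - r1) ^+ 2 =
  4 * (p1 + r1) * (1 + p1 * r1) by ring.
by rewrite gt_eqF // !mulr_gt0 ?addr_gt0 ?mulr_gt0.
Qed.

Let generic : r4 != 1 -> p2 != 1 -> False.
Proof.
move=> r41 p21.
have c10 : c1 != 0 by apply: sqr_neq1.
have b20 : b2 != 0 by apply: sqr_neq1.
pose e2 := p2 * r2 + 1; pose e3 := p3 * r3 + 1; pose e4 := p4 * r4 + 1.
pose D2 := p2 + r2; pose D4 := p4 + r4; pose D3 := p3 + r3.
pose c4 := r3 ^+ 2 - 1; pose b3 := p3 ^+ 2 - 1.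
(* The product s t enters only through the mixed term of [F3], and its factor p3 r3 + 1 is positive,
   so face 3 needs no case distinction. *)
have k0 : 2 * e3 * b2 * c1 * D2 * D4 != 0.
  by rewrite !mulf_neq0 ?pnatr_eq0 // gt_eqF ?addr_gt0 ?mulr_gt0.
(* b2 ^ 2 c1 ^ 2 times the relation F3, with x3 and x4 expressed by s and t. *)
apply: (two_sqrt_free zinj (squarefree_quadratic (discA r41))
  (squarefree_quadratic (discB p21))
  (quadratic_size_neq1 (discA r41)) (quadratic_size_neq1 (discB p21)) tA sB k0 nAB
  (U := (c4 * c1 ^+ 2 * D2 ^+ 2)%:P * B + (c4 * c1 ^+ 2 * e2 ^+ 2)%:P * Y ^+ 2 +
     (2 * e3 * b2 * c1 * e2 * e4)%:P * X * Y + (b3 * b2 ^+ 2 * D4 ^+ 2)%:P * A +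
     (b3 * b2 ^+ 2 * e4 ^+ 2)%:P * X ^+ 2 - (4 * D3 ^+ 2 * b2 ^+ 2 * c1 ^+ 2)%:P * 'X)
  (V := (- 2 * c4 * c1 ^+ 2 * D2 * e2)%:P * Y - (2 * e3 * b2 * c1 * D2 * e4)%:P * X)
  (W := (- 2 * e3 * b2 * c1 * e2 * D4)%:P * Y - (2 * b3 * b2 ^+ 2 * D4 * e4)%:P * X))
    => n.
have D20 : D2 != 0 by rewrite gt_eqF ?addr_gt0.
have D40 : D4 != 0 by rewrite gt_eqF ?addr_gt0.
have E3 : D2 * s n - e2 * Y.[z n] = b2 * x3 n by rewrite /s -/D2 -/e2; field.
have E4 : D4 * t n - e4 * X.[z n] = c1 * x4 n by rewrite /t -/D4 -/e4; field.
have := F3 n; rewrite /scaled_conic -/c4 -/e3 -/b3 -/D3.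
move: (tA n) (sB n) E3 E4; move: (s n) (t n) => hs ht.
generalize A B X Y => A' B' X' Y' tAn sBn E3 E4 F3n.
rewrite !(hornerD, hornerN, hornerM, hornerC, horner_exp, hornerX) -sBn -tAn.
set hX := X'.[z n] in E4 *; set hY := Y'.[z n] in E3 *.
set h3 := x3 n in F3n E3 *; set h4 := x4 n in F3n E4 *.
transitivity (c4 * c1 ^+ 2 * (D2 * hs - e2 * hY) ^+ 2 +
  2 * e3 * b2 * c1 * (D2 * hs - e2 * hY) * (D4 * ht - e4 * hX)
  + b3 * b2 ^+ 2 * (D4 * ht - e4 * hX) ^+ 2 - 4 * D3 ^+ 2 * b2 ^+ 2 * c1 ^+ 2 * z n);
    first by ring.
rewrite E3 E4; transitivity (b2 ^+ 2 * c1 ^+ 2 *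
  ((c4 * h3 ^+ 2 + 2 * e3 * h3 * h4 + b3 * h4 ^+ 2) - 4 * z n * D3 ^+ 2)); first by ring.
by rewrite F3n subrr mulr0.
Qed.

(* If r4 = 1 then x4 is a rational function of x1, with numerator N and denominator
   2 X after scaling; likewise for x3, M and 2 Y if p2 = 1. *)
Let N : {poly R} := (4 * (p4 + 1))%:P * 'X - (p4 - 1)%:P * X ^+ 2.
Let M : {poly R} := (4 * (r2 + 1))%:P * 'X - (r2 - 1)%:P * Y ^+ 2.

Let X0 : X != 0.
Proof.
apply/eqP => X0; have : X.[1] = 2 by rewrite /X !hE; ring.
by rewrite X0 horner0 => /eqP; rewrite eq_sym pnatr_eq0.
Qed.

Let Y0 : Y != 0.
Proof.
apply/eqP => Y0; have : Y.[1] = 2 by rewrite /Y !hE; ring.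
by rewrite Y0 horner0 => /eqP; rewrite eq_sym pnatr_eq0.
Qed.

Let NX : r4 = 1 -> forall n, 2 * x4 n * X.[z n] = N.[z n].
Proof.
move=> r41 n; have p40 : p4 + 1 != 0 by rewrite gt_eqF ?addr_gt0.
apply: (mulfI p40); rewrite /N; have := F4 n; rewrite /scaled_conic r41.
move: X => X'; rewrite !hE => F4n.
transitivity ((1 ^+ 2 - 1) * x4 n ^+ 2 + 2 * (p4 * 1 + 1) * x4 n * X'.[z n] +
  (p4 ^+ 2 - 1) * X'.[z n] ^+ 2 - (p4 ^+ 2 - 1) * X'.[z n] ^+ 2); first by ring.
by rewrite F4n; ring.
Qed.

Let MY : p2 = 1 -> forall n, 2 * x3 n * Y.[z n] = M.[z n].
Proof.
move=> p21 n; have r20 : r2 + 1 != 0 by rewrite gt_eqF ?addr_gt0.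
apply: (mulfI r20); rewrite /M; have := F2 n; rewrite /scaled_conic p21.
move: Y => Y'; rewrite !hE => F2n.
transitivity ((r2 ^+ 2 - 1) * Y'.[z n] ^+ 2 + 2 * (1 * r2 + 1) * Y'.[z n] * x3 n +
  (1 ^+ 2 - 1) * x3 n ^+ 2 - (r2 ^+ 2 - 1) * Y'.[z n] ^+ 2); first by ring.
by rewrite F2n; ring.
Qed.

(** The roots of [X] and [Y], that is, the poles of the rational functions N / (2 X) and M / (2 Y):
    there a relation cleared of denominators keeps only its most singular term. For [r1] = 1, [zY]
    is the default value 0 and not a root. *)
Let zX := (p1 - 1) / (1 + p1).
Let zY := (r1 + 1) / (r1 - 1).

Let XzX : X.[zX] = 0.
Proof.
have p10 : 1 + p1 != 0 by rewrite gt_eqF ?addr_gt0.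
by rewrite /X !hE /zX; field.
Qed.

Let YzX : Y.[zX] != 0.
Proof.
have p10 : 1 + p1 != 0 by rewrite gt_eqF ?addr_gt0.
have -> : Y.[zX] = 2 * (p1 + r1) / (1 + p1) by rewrite /Y !hE /zX; field.
by rewrite !mulf_neq0 ?invr_eq0 ?pnatr_eq0 // gt_eqF ?addr_gt0.
Qed.

Let NzX : p1 != 1 -> N.[zX] != 0.
Proof.
move=> p11; have p10 : 1 + p1 != 0 by rewrite gt_eqF ?addr_gt0.
have -> : N.[zX] = 4 * (p4 + 1) * zX.
  by rewrite /N; move: XzX; generalize X => X' X'0; rewrite !hE X'0; ring.
by rewrite !mulf_neq0 ?pnatr_eq0 ?invr_eq0 ?subr_eq0 // gt_eqF ?addr_gt0.
Qed.

Let YzY : r1 != 1 -> Y.[zY] = 0.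
Proof. by move=> r11; rewrite /Y !hE /zY; field; rewrite subr_eq0. Qed.

Let XzY : r1 != 1 -> X.[zY] != 0.
Proof.
move=> r11; have r10 : r1 - 1 != 0 by rewrite subr_eq0.
have -> : X.[zY] = 2 * (p1 + r1) / (r1 - 1) by rewrite /X !hE /zY; field.
by rewrite !mulf_neq0 ?invr_eq0 ?pnatr_eq0 // gt_eqF ?addr_gt0.
Qed.

Let MzY : r1 != 1 -> M.[zY] != 0.
Proof.
move=> r11; have r10 : r1 - 1 != 0 by rewrite subr_eq0.
have -> : M.[zY] = 4 * (r2 + 1) * zY.
  by rewrite /M; move: (YzY r11); generalize Y => Y' Y'0; rewrite !hE Y'0; ring.
by rewrite !mulf_neq0 ?pnatr_eq0 ?invr_eq0 // gt_eqF ?addr_gt0.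
Qed.

Let half_rational : r4 = 1 -> p2 != 1 -> False.
Proof.
move=> r41 p21; have b20 : b2 != 0 by apply: sqr_neq1.
pose e2 := p2 * r2 + 1; pose e3 := p3 * r3 + 1.
pose D2 := p2 + r2; pose D3 := p3 + r3.
pose c4 := r3 ^+ 2 - 1; pose b3 := p3 ^+ 2 - 1.
have D20 : D2 != 0 by rewrite gt_eqF ?addr_gt0.
(* The relation is 4 b2^2 X^2 times [F3], with x3 expressed by s and 2 X x4 by [N]. *)
have [|_ V0] := sqrt_free zinj (squarefree_quadratic (discB p21))
  (quadratic_size_neq1 (discB p21)) sB
  (U := (4 * c4)%:P * X ^+ 2 * ((D2 ^+ 2)%:P * B + (e2 ^+ 2)%:P * Y ^+ 2) -
     (4 * e3 * b2 * e2)%:P * X * Y * N + (b3 * b2 ^+ 2)%:P * N ^+ 2 -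
     (16 * D3 ^+ 2 * b2 ^+ 2)%:P * 'X * X ^+ 2)
  (V := X * ((4 * e3 * b2 * D2)%:P * N - (8 * c4 * D2 * e2)%:P * X * Y)).
  move=> n.
  have E3 : D2 * s n - e2 * Y.[z n] = b2 * x3 n by rewrite /s -/D2 -/e2; field.
  have := F3 n; rewrite /scaled_conic -/c4 -/e3 -/b3 -/D3.
  move: (NX r41 n) (sB n) E3; move: (s n) => hs.
  generalize N B X Y => N' B' X' Y' N'n sBn E3 F3n.
  rewrite !(hornerD, hornerN, hornerM, hornerC, horner_exp, hornerX) -sBn -N'n.
  transitivity (4 * X'.[z n] ^+ 2 * (c4 * (D2 * hs - e2 * Y'.[z n]) ^+ 2 +
    2 * e3 * b2 * (D2 * hs - e2 * Y'.[z n]) * x4 n +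
    b3 * b2 ^+ 2 * x4 n ^+ 2 - 4 * z n * D3 ^+ 2 * b2 ^+ 2)); first by ring.
  rewrite E3; transitivity (4 * X'.[z n] ^+ 2 * b2 ^+ 2 * (c4 * x3 n ^+ 2 +
    2 * e3 * x3 n * x4 n + b3 * x4 n ^+ 2 - 4 * z n * D3 ^+ 2)); first by ring.
  by rewrite F3n subrr mulr0.
move/eqP: V0; rewrite mulf_eq0 (negPf X0) /= => /eqP V0.
have p11 : p1 != 1 by rewrite -r41 eq_sym.
have : 4 * e3 * b2 * D2 * N.[zX] = 0.
  transitivity (((4 * e3 * b2 * D2)%:P * N - (8 * c4 * D2 * e2)%:P * X * Y).[zX]).
    move: XzX; generalize N X Y => N' X' Y' X'0.
    by rewrite !(hornerD, hornerN, hornerM, hornerC) X'0; ring.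
  by rewrite V0 horner0.
apply/eqP; rewrite !mulf_neq0 ?pnatr_eq0 ?NzX //.
by rewrite gt_eqF ?addr_gt0 ?mulr_gt0.
Qed.

Let both_rational : r4 = 1 -> p2 = 1 -> False.
Proof.
move=> r41 p21.
have p11 : p1 != 1 by rewrite -r41 eq_sym.
have r11 : r1 != 1 by rewrite -p21.
pose e3 := p3 * r3 + 1; pose D3 := p3 + r3.
pose c4 := r3 ^+ 2 - 1; pose b3 := p3 ^+ 2 - 1.
pose P := c4%:P * (M ^+ 2 * X ^+ 2) + (2 * e3)%:P * (M * N * X * Y) +
  b3%:P * (N ^+ 2 * Y ^+ 2) -
  (16 * D3 ^+ 2)%:P * 'X * (X ^+ 2 * Y ^+ 2).
have P0 : P = 0.
  apply: (poly_eq0_injective zinj) => n; rewrite /P.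
  have := F3 n; rewrite /scaled_conic -/c4 -/e3 -/b3 -/D3.
  move: (NX r41 n) (MY p21 n); generalize M N X Y => M' N' X' Y' N'n M'n F3n.
  rewrite !(hornerD, hornerN, hornerM, hornerC, horner_exp, hornerX) -N'n -M'n.
  transitivity (4 * X'.[z n] ^+ 2 * Y'.[z n] ^+ 2 * (c4 * x3 n ^+ 2 +
    2 * e3 * x3 n * x4 n + b3 * x4 n ^+ 2 - 4 * z n * D3 ^+ 2)); first by ring.
  by rewrite F3n subrr mulr0.
(* Only the x4^2 term of [F3] survives at the pole of x4, and only the x3^2 term at the pole of x3;
   both coefficients vanish, so p3 = r3 = 1. *)
have b30 : b3 = 0.
  have : b3 * (N.[zX] ^+ 2 * Y.[zX] ^+ 2) = 0.
    transitivity P.[zX]; last by rewrite P0 horner0.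
    rewrite /P; move: XzX; generalize M N X Y => M' N' X' Y' X'0.
    by rewrite !(hornerD, hornerN, hornerM, hornerC, horner_exp) X'0; ring.
  by move/eqP; rewrite mulf_eq0 (negPf (mulf_neq0 _ _)) ?expf_neq0 ?NzX ?YzX // orbF
    => /eqP.
have c40 : c4 = 0.
  have : c4 * (M.[zY] ^+ 2 * X.[zY] ^+ 2) = 0.
    transitivity P.[zY]; last by rewrite P0 horner0.
    rewrite /P; move: (YzY r11); generalize M N X Y => M' N' X' Y' Y'0.
    by rewrite !(hornerD, hornerN, hornerM, hornerC, horner_exp) Y'0; ring.
  by move/eqP; rewrite mulf_eq0 (negPf (mulf_neq0 _ _)) ?expf_neq0 ?MzY ?XzY // orbF
    => /eqP.
have p31 : p3 = 1 by apply/eqP; apply: contraPT b30 => /(sqr_neq1 p3_gt0)/eqP.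
have r31 : r3 = 1 by apply/eqP; apply: contraPT c40 => /(sqr_neq1 r3_gt0)/eqP.
(* For p3 = r3 = 1 the polynomial [P] is 4 X Y (M N - 16 z X Y), and the first factor cancels. *)
have Q0 : M * N - 16%:P * 'X * X * Y = 0.
  apply: (mulfI (mulf_neq0 (_ : 4%:P != 0) (mulf_neq0 X0 Y0))).
    by rewrite polyC_eq0 pnatr_eq0.
  rewrite mulr0 -[RHS]P0 /P b30 c40 /e3 /D3 p31 r31.
  have -> : 2 * (1 * 1 + 1) = 4 :> R by ring.
  have -> : 16 * (1 + 1) ^+ 2 = 4 * 16 :> R by ring.
  by rewrite polyCM; generalize M N X Y => M' N' X' Y'; ring.
have : ((p4 - 1) * (r2 - 1)) * (24 * (1 + p1) ^+ 2 * (1 - r1) ^+ 2) = 0.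
  (* The fourth difference isolates the leading coefficient. *)
  pose Q := M * N - 16%:P * 'X * X * Y.
  transitivity (Q.[2] - 4 * Q.[1] + 6 * Q.[0] - 4 * Q.[-1] + Q.[-2]).
    by rewrite /Q /M /N /X /Y !hE; ring.
  by rewrite /Q Q0 !horner0; ring.
have nz : 24 * (1 + p1) ^+ 2 * (1 - r1) ^+ 2 != 0.
  by rewrite !mulf_neq0 ?pnatr_eq0 ?subr_eq0 1?(eq_sym 1) // gt_eqF ?addr_gt0.
move/eqP; rewrite mulf_eq0 (negPf nz) orbF mulf_eq0 !subr_eq0 => /orP[/eqP p41|/eqP r21].
  (* With [p4] = 1 the numerator [N] is 8 z, so the identity at the root of [Y] would make [M]
     vanish there. *)
  have : 8 * zY * M.[zY] = 0.
    transitivity ((M * N - 16%:P * 'X * X * Y).[zY]); last by rewrite Q0 horner0.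
    rewrite /N p41; move: (YzY r11); generalize M X Y => M' X' Y' Y'0.
    by rewrite !(hornerD, hornerN, hornerM, hornerC, horner_exp, hornerX) Y'0; ring.
  apply/eqP; rewrite !mulf_neq0 ?pnatr_eq0 ?MzY ?invr_eq0 ?subr_eq0 //.
  by rewrite gt_eqF ?addr_gt0.
have : 8 * zX * N.[zX] = 0.
  transitivity ((M * N - 16%:P * 'X * X * Y).[zX]); last by rewrite Q0 horner0.
  rewrite /M r21; move: XzX; generalize N X Y => N' X' Y' X'0.
  by rewrite !(hornerD, hornerN, hornerM, hornerC, horner_exp, hornerX) X'0; ring.
apply/eqP; rewrite !mulf_neq0 ?pnatr_eq0 ?NzX ?invr_eq0 ?subr_eq0 //.
by rewrite gt_eqF ?addr_gt0.
Qed.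

Lemma unmatched_adjacent_scaled : p2 = 1 /\ r4 != 1.
Proof.
have [r41|r41] := eqVneq r4 1; have [p21|p21] := eqVneq p2 1; split=> //; exfalso.
all: first [exact: both_rational | exact: half_rational | exact: generic].
Qed.

End Adjacent.

(** * Hyperbolas glued along matched edges *)

Lemma hyperbola_param (p r x y : R) : 0 < p -> 0 < r -> admissible p r x y ->
  let c := (r * x + p * y) / (p + r) in let h := (x - y) / (p + r) in
  [/\ 0 < c, c ^+ 2 - h ^+ 2 = 1, x = c + p * h & y = c - r * h].
Proof.
move=> p0 r0 [x0 y0 _ _ C] c h; have D0 : p + r != 0 by rewrite gt_eqF ?addr_gt0.
split; try by rewrite /c /h; field.
  by rewrite /c divr_gt0 ?addr_gt0 ?mulr_gt0.
by rewrite /c /h !expr_div_n -mulrBl C divff ?expf_neq0.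
Qed.

(** For c = cosh and h = sinh the last hypothesis equates two values of tanh, which is injective on
    the branch c > 0. *)
Lemma hyperbola_inj (c h c' h' : R) : 0 < c -> 0 < c' ->
  c ^+ 2 - h ^+ 2 = 1 -> c' ^+ 2 - h' ^+ 2 = 1 -> c * h' = c' * h -> h = h'.
Proof.
move=> c0 c0' e e' E.
have : h ^+ 2 = h' ^+ 2.
  transitivity (h ^+ 2 * (c' ^+ 2 - h' ^+ 2)); first by rewrite e' mulr1.
  transitivity ((c' * h) ^+ 2 - h ^+ 2 * h' ^+ 2); first by ring.
  rewrite -E; transitivity (h' ^+ 2 * (c ^+ 2 - h ^+ 2)); first by ring.
  by rewrite e mulr1.
move/eqP; rewrite eqf_sqr => /orP[/eqP//|/eqP hh].
have : (c + c') * h' = 0 by rewrite mulrDl E hh mulrN addNr.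
move/eqP; rewrite mulf_eq0 (gt_eqF (addr_gt0 c0 c0')) => /eqP h'0.
by rewrite hh h'0 oppr0.
Qed.

(* The remaining case p2 = 1, r4 <> 1 is excluded below by exchanging the roles of the
   edges 1 and 2. *)
Lemma unmatched_adjacent (p1 r1 p2 r2 p3 r3 p4 r4 : R) (x1 x2 x3 x4 : nat -> R) :
  [/\ 0 < p1, 0 < r1, 0 < p2 & 0 < r2] -> [/\ 0 < p3, 0 < r3, 0 < p4 & 0 < r4] ->
  injective x1 ->
  (forall n, admissible p1 r1 (x1 n) (x2 n)) ->
  (forall n, admissible p2 r2 (x2 n) (x3 n)) ->
  (forall n, admissible p3 r3 (x3 n) (x4 n)) ->
  (forall n, admissible p4 r4 (x4 n) (x1 n)) ->
  r4 != p1 -> r1 != p2 -> p2 = 1 /\ r4 != 1.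
Proof.
move=> [p10 r10 p20 r20] [p30 r30 p40 r40] inj F1 F2 F3 F4 bad1 bad2.
pose c n := (r1 * x1 n + p1 * x2 n) / (p1 + r1).
pose h n := (x1 n - x2 n) / (p1 + r1).
(* This plays e^tau; it is positive because (c + h) (c - h) = 1 and c > 0. *)
pose e n := c n + h n.
have H n : [/\ 0 < c n, c n ^+ 2 - h n ^+ 2 = 1, x1 n = c n + p1 * h n &
    x2 n = c n - r1 * h n] by exact: hyperbola_param p10 r10 (F1 n).
have e0 n : 0 < e n.
  have [c0 ch _ _] := H n; rewrite ltNge; apply/negP => e_le0.
  have ch_le0 : c n + h n <= 0 := e_le0.
  have : e n * (c n - h n) <= 0 by apply: mulr_le0_ge0 => //; lra.
  by apply/negP; rewrite -ltNge [X in _ < X](_ : _ = 1) ?ltr01 // -ch /e; ring.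
have X1 n : (1 + p1) * e n ^+ 2 + (1 - p1) = 2 * e n * x1 n.
  have [_ ch x1E _] := H n; rewrite [X in _ = _ * X]x1E.
  transitivity ((1 + p1) * e n ^+ 2 + (1 - p1) * (c n ^+ 2 - h n ^+ 2)).
    by rewrite ch mulr1.
  by rewrite /e; ring.
have einj : injective (fun n => e n ^+ 2).
  move=> m n E; apply: inj.
  have emn : e m = e n by apply/eqP; rewrite -(@eqrXn2 _ 2) ?ltW ?E.
  apply: (mulfI (_ : 2 * e m != 0)); first by rewrite mulf_neq0 ?pnatr_eq0 ?gt_eqF.
  by rewrite -X1 [in RHS]emn -X1 emn.
have Y1 n : (1 - r1) * e n ^+ 2 + (1 + r1) = 2 * e n * x2 n.
  have [_ ch _ x2E] := H n; rewrite [X in _ = _ * X]x2E.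
  transitivity ((1 - r1) * e n ^+ 2 + (1 + r1) * (c n ^+ 2 - h n ^+ 2)).
    by rewrite ch mulr1.
  by rewrite /e; ring.
have S p r x y n : admissible p r x y ->
  scaled_conic p r (2 * e n * x) (2 * e n * y) (e n ^+ 2).
  by case=> _ _ _ _ /conicE E; rewrite /scaled_conic -E; ring.
apply: (@unmatched_adjacent_scaled p1 r1 p2 r2 p3 r3 p4 r4 _ (fun n => 2 * e n * x3 n)
  (fun n => 2 * e n * x4 n)
  p10 r10 p20 r20 p30 r30 p40 r40 einj bad1 bad2) => n;
    rewrite ?(hornerD, hornerM, hornerC, hornerX) ?X1 ?Y1; exact: S.
Qed.

Lemma adjacent_match (p1 r1 p2 r2 p3 r3 p4 r4 : R) (x1 x2 x3 x4 : nat -> R) :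
  [/\ 0 < p1, 0 < r1, 0 < p2 & 0 < r2] -> [/\ 0 < p3, 0 < r3, 0 < p4 & 0 < r4] ->
  injective x1 ->
  (forall n, admissible p1 r1 (x1 n) (x2 n)) ->
  (forall n, admissible p2 r2 (x2 n) (x3 n)) ->
  (forall n, admissible p3 r3 (x3 n) (x4 n)) ->
  (forall n, admissible p4 r4 (x4 n) (x1 n)) ->
  r4 = p1 \/ r1 = p2.
Proof.
move=> pos pos' inj F1 F2 F3 F4.
have [->|bad1] := eqVneq r4 p1; first by left.
have [->|bad2] := eqVneq r1 p2; first by right.
have [p21 r41] := unmatched_adjacent pos pos' inj F1 F2 F3 F4 bad1 bad2.
have inj2 : injective x2.
  by move=> m n E; apply: inj; have Fm := F1 m; rewrite E in Fm;
    exact: admissible_injl Fm (F1 n).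
(* Traversing the cycle backwards exchanges p and r in every face and swaps edges 1 and 2. *)
have [r4_1 _] : r4 = 1 /\ p2 != 1.
  case: pos pos' => ? ? ? ? [? ? ? ?].
  apply: (@unmatched_adjacent r1 p1 r4 p4 r3 p3 r2 p2 x2 x1 x4 x3) => //;
    by [rewrite eq_sym | move=> n; exact: admissibleC].
by rewrite r4_1 eqxx in r41.
Qed.

(** Both faces have the parameter r at the common edge y = c - r h, so the second face has the same
    c and the opposite h. It lies on the right branch because both branch conditions are positive
    multiples of r c - h. *)
Lemma hyperbola_glue (p r q x y w : R) : 0 < p -> 0 < r -> 0 < q ->
  admissible p r x y -> admissible r q y w ->
  exists c h, [/\ 0 < c, c ^+ 2 - h ^+ 2 = 1, x = c + p * h,
    y = c - r * h & w = c + q * h].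
Proof.
move=> p0 r0 q0 A1 A2; have [c0 ch xE yE] := hyperbola_param p0 r0 A1.
set c := (r * x + p * y) / (p + r) in c0 ch xE yE.
set h := (x - y) / (p + r) in c0 ch xE yE.
exists c, h; split=> //; case: A2 => _ _ s0 _ C2; apply: (conic_inj C2) => //.
  rewrite /conic yE; transitivity ((r + q) ^+ 2 * (c ^+ 2 - h ^+ 2)); first by ring.
  by rewrite ch mulr1.
case: A1 => _ _ _ t0 _; have : (r ^+ 2 - 1) * x + (p * r + 1) * y = (p + r) * (r * c - h).
  by rewrite xE yE; ring.
have -> : (r * q + 1) * y + (r ^+ 2 - 1) * (c + q * h) = (r + q) * (r * c - h).
  by rewrite yE; ring.
by move=> E; move: t0; rewrite E (pmulr_rgt0 _ (addr_gt0 p0 r0))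
  (pmulr_rgt0 _ (addr_gt0 r0 q0)).
Qed.

(** Gluing over edges 2 and 4 describes (x1, x3) in two ways, as (c + p1 h, c + r2 h) and as (c' +
    r4 h', c' + p3 h'). If p1 = r2, both describe the line x1 = x3. Otherwise h' = l h and c' = c +
    u h, and a map of this form that keeps infinitely many points on the hyperbola has u = 0 and l^2
    = 1. *)
Lemma opposite_match (p1 r1 p2 r2 p3 r3 p4 r4 : R) (x1 x2 x3 x4 : nat -> R) :
  [/\ 0 < p1, 0 < r1, 0 < p2 & 0 < r2] -> [/\ 0 < p3, 0 < r3, 0 < p4 & 0 < r4] ->
  injective x1 ->
  (forall n, admissible p1 r1 (x1 n) (x2 n)) ->
  (forall n, admissible p2 r2 (x2 n) (x3 n)) ->
  (forall n, admissible p3 r3 (x3 n) (x4 n)) ->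
  (forall n, admissible p4 r4 (x4 n) (x1 n)) ->
  r1 = p2 -> r3 = p4 -> (r4 = p1 /\ r2 = p3) \/ (p1 = r2 /\ p3 = r4).
Proof.
move=> [p10 r10 p20 r20] [p30 r30 p40 r40] inj F1 F2 F3 F4 E1 E3.
have /choice[c /choice[h H]] : forall n, exists c h,
  [/\ 0 < c, c ^+ 2 - h ^+ 2 = 1, x1 n = c + p1 * h & x3 n = c + r2 * h].
  move=> n; have F2n := F2 n; rewrite -E1 in F2n.
  by have [c [h [? ? ? _ ?]]] := hyperbola_glue p10 r10 r20 (F1 n) F2n; exists c, h.
have /choice[c' /choice[h' H']] : forall n, exists c h,
    [/\ 0 < c, c ^+ 2 - h ^+ 2 = 1, x3 n = c + p3 * h & x1 n = c + r4 * h].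
  move=> n; have F4n := F4 n; rewrite -E3 in F4n.
  by have [c' [h' [? ? ? _ ?]]] := hyperbola_glue p30 r30 r40 (F3 n) F4n; exists c', h'.
have not_const (a b : nat -> R) q : (forall n, b n = 0) -> (forall n, 0 < a n) ->
    (forall n, a n ^+ 2 - b n ^+ 2 = 1) -> ~ (forall n, x1 n = a n + q * b n).
  move=> b0 a0 ab x1E; have a1 n : a n = 1.
    apply/eqP; rewrite -(@eqrXn2 _ 2) ?ltW // expr1n -(ab n).
    by rewrite b0 expr0n subr0.
  by have /inj : x1 0 = x1 1 by rewrite !x1E !a1 !b0.
have E13 (a b : nat -> R) q s : q != s -> (forall n, x1 n = a n + q * b n) ->
    (forall n, x3 n = a n + s * b n) -> (forall n, x1 n = x3 n) -> forall n, b n = 0.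
  move=> qs x1E x3E x13 n; have /eqP : (q - s) * b n = 0.
    by transitivity (x1 n - x3 n); [rewrite x1E x3E; ring|rewrite x13 subrr].
  by rewrite mulf_eq0 subr_eq0 (negPf qs) => /eqP.
have [pr|pr] := eqVneq p1 r2.
  right; split=> //; apply/eqP; apply: contraT => p3r4; exfalso.
  have h0 : forall n, h' n = 0.
    apply: (E13 c' h' r4 p3); rewrite 1?eq_sym // => n; first by have [] := H' n.
      by have [] := H' n.
    by have [_ _ -> ->] := H n; rewrite pr.
  by apply: (not_const c' h' r4 h0) => n; have [] := H' n.
have p3r4 : p3 - r4 != 0.
  rewrite subr_eq0; apply/eqP => p3r4.
  have h0 : forall n, h n = 0.
    apply: (E13 c h p1 r2) => // n; try by have [] := H n.
    by have [_ _ -> ->] := H' n; rewrite p3r4.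
  by apply: (not_const c h p1 h0) => n; have [] := H n.
left.
pose l := (r2 - p1) / (p3 - r4); pose u := p1 - r4 * l.
have hE n : h' n = l * h n.
  apply: (mulfI p3r4); rewrite mulrA [_ * l]mulrC divfK //.
  have [_ _ e1 e3] := H n; have [_ _ e3' e1'] := H' n.
  transitivity (x3 n - x1 n); first by rewrite e3' e1'; ring.
  by rewrite e1 e3; ring.
have cE n : c' n = c n + u * h n.
  have [_ _ e1 _] := H n; have [_ _ _ e1'] := H' n.
  apply: (addIr (r4 * h' n)); rewrite -e1' e1 hE /u; ring.
(* The difference of the two hyperbola equations, divided by [h n]. If u were nonzero, it would fix
   the ratio h / c, and [hyperbola_inj] would identify any two such points. *)
have uE n : h n != 0 -> 2 * u * c n = - (u ^+ 2 - l ^+ 2 + 1) * h n.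
  move=> hn; apply: (mulIf hn); have [_ e _ _] := H n; have [_ e' _ _] := H' n.
  apply/eqP; rewrite -subr_eq0; apply/eqP.
  transitivity ((c' n ^+ 2 - h' n ^+ 2) - (c n ^+ 2 - h n ^+ 2)).
    by rewrite hE cE; ring.
  by rewrite e e' subrr.
have hinj : injective h.
  move=> m n E; apply: inj; have [cm em -> _] := H m; have [cn en -> _] := H n.
  rewrite E; congr (_ + _); apply/eqP; rewrite -(@eqrXn2 _ 2) ?ltW //.
  by rewrite -(subrK (h m ^+ 2) (c m ^+ 2)) em E -en subrK.
(* Being injective, [h] vanishes for at most one of the first three indices. *)
have [m [n [mn hm hn]]] : exists m n, [/\ m != n, h m != 0 & h n != 0].
  have [h0|h0] := eqVneq (h 0) 0; [exists 1, 2 | have [h1|h1] := eqVneq (h 1) 0;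
    [exists 0, 2 | by exists 0, 1]].
    by split=> //; rewrite -h0; apply/eqP => /hinj.
  by split=> //; rewrite -h1; apply/eqP => /hinj.
have u0 : u = 0.
  apply/eqP; apply: contraNT mn => u0; apply/eqP/hinj.
  have [cm em _ _] := H m; have [cn en _ _] := H n.
  apply: (hyperbola_inj cm cn em en).
  apply: (mulfI (mulf_neq0 (_ : 2 != 0) u0)); first by rewrite pnatr_eq0.
  by rewrite !mulrA (uE m) // (uE n) //; ring.
have l2 : l ^+ 2 = 1.
  apply: (mulIf hm); have := uE m hm; rewrite u0 => e.
  by transitivity (- (0 ^+ 2 - l ^+ 2 + 1) * h m + h m); [ring | rewrite -e; ring].
have p1E : p1 = r4 * l by apply/eqP; rewrite -subr_eq0 -/u u0.
(* The value l = -1 would give p1 = - r4 < 0. *)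
have l1 : l = 1.
  move/eqP: l2; rewrite sqrf_eq1 => /orP[/eqP//|/eqP lN1].
  by move: p10; rewrite p1E lN1 mulrN1 oppr_gt0 ltNge ltW.
move: p1E; rewrite l1 mulr1 => p1E; split=> //.
have : r2 - p1 = p3 - r4 by rewrite -[RHS]mul1r -l1 divfK.
by rewrite p1E => /addIr.
Qed.

Lemma infinite_family_cases (p1 r1 p2 r2 p3 r3 p4 r4 : R) (x1 x2 x3 x4 : nat -> R) :
  [/\ 0 < p1, 0 < r1, 0 < p2 & 0 < r2] -> [/\ 0 < p3, 0 < r3, 0 < p4 & 0 < r4] ->
  injective x1 ->
  (forall n, admissible p1 r1 (x1 n) (x2 n)) ->
  (forall n, admissible p2 r2 (x2 n) (x3 n)) ->
  (forall n, admissible p3 r3 (x3 n) (x4 n)) ->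
  (forall n, admissible p4 r4 (x4 n) (x1 n)) ->
  [\/ [/\ r1 = p2, r2 = p3, r3 = p4 & r4 = p1],
      [/\ p1 = r2, r1 = p2, p3 = r4 & r3 = p4] |
      [/\ p2 = r3, r2 = p3, p4 = r1 & r4 = p1]].
Proof.
move=> pos pos' inj F1 F2 F3 F4.
have inj2 : injective x2.
  by move=> m n E; apply: inj; have Fm := F1 m; rewrite E in Fm;
    exact: admissible_injl Fm (F1 n).
have inj3 : injective x3.
  by move=> m n E; apply: inj2; have Fm := F2 m; rewrite E in Fm;
    exact: admissible_injl Fm (F2 n).
have inj4 : injective x4.
  by move=> m n E; apply: inj3; have Fm := F3 m; rewrite E in Fm;
    exact: admissible_injl Fm (F3 n).
have [p10 r10 p20 r20] := pos; have [p30 r30 p40 r40] := pos'.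
have P1 : [/\ 0 < p2, 0 < r2, 0 < p3 & 0 < r3] by [].
have P2 : [/\ 0 < p4, 0 < r4, 0 < p1 & 0 < r1] by [].
have := opposite_match pos pos' inj F1 F2 F3 F4.
have := opposite_match P1 P2 inj2 F2 F3 F4 F1.
(* The matched edges meet every pair of neighbours in a cycle of four, hence include two opposite
   ones, to which [opposite_match] applies. *)
have [m1|m1] := adjacent_match pos pos' inj F1 F2 F3 F4;
have [m2|m2] := adjacent_match P1 P2 inj2 F2 F3 F4 F1;
have [m3|m3] := adjacent_match pos' pos inj3 F3 F4 F1 F2;
have [m4|m4] := adjacent_match P2 P1 inj4 F4 F1 F2 F3; move=> O1 O2;
  first [by have [[? ?]|[? ?]] := O1 ltac:(assumption) ltac:(assumption);
    [apply: Or31 | apply: Or33]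
  | by have [[? ?]|[? ?]] := O2 ltac:(assumption) ltac:(assumption);
    [apply: Or31 | apply: Or32]].
Qed.
End Curves.

(** * The branch of a hyperbola through (1, 1) *)

Section Curve.
Variable R : realType.
Implicit Types p r x y c h : R.

(* The solution h of x = c + p h, c ^ 2 - h ^ 2 = 1 that vanishes at x = 1,
   written so that it remains defined for p = 1. *)
Definition sinh_of p x : R := (x ^+ 2 - 1) / (p * x + Num.sqrt (x ^+ 2 + p ^+ 2 - 1)).

Definition branch p r x : R := x - (p + r) * sinh_of p x.

(** For x >= 1 the radicand is nonnegative for every p; hence the deformation below lives on an
    interval starting at 1. *)
Lemma sinh_ofP p x : 0 < p -> 1 <= x -> (x - p * sinh_of p x) ^+ 2 - sinh_of p x ^+ 2 = 1.
Proof.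
move=> p0 x1; rewrite /sinh_of; set s := Num.sqrt _.
have x0 : 0 < x by rewrite (lt_le_trans ltr01).
have s2 : s ^+ 2 = x ^+ 2 + p ^+ 2 - 1.
  by rewrite sqr_sqrtr // -addrA addrCA addr_ge0 ?sqr_ge0 // subr_ge0 exprn_ege1.
have Dn : p * x + s != 0 by rewrite gt_eqF // ltr_wpDr ?sqrtr_ge0 ?mulr_gt0.
have E : (p * x + s) ^+ 2 - 2 * p * x * (p * x + s) + (p ^+ 2 - 1) * (x ^+ 2 - 1) = 0.
  transitivity (s ^+ 2 - p ^+ 2 * x ^+ 2 + (p ^+ 2 - 1) * (x ^+ 2 - 1)); first by ring.
  by rewrite s2; ring.
apply/eqP; rewrite -subr_eq0; apply/eqP.
transitivity ((x ^+ 2 - 1) / (p * x + s) ^+ 2 *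
  ((p * x + s) ^+ 2 - 2 * p * x * (p * x + s) + (p ^+ 2 - 1) * (x ^+ 2 - 1))).
  by field.
by rewrite E mulr0.
Qed.

Lemma conic_hyperbola p r c h : c ^+ 2 - h ^+ 2 = 1 -> conic p r (c + p * h) (c - r * h).
Proof.
move=> e; rewrite /conic; transitivity ((p + r) ^+ 2 * (c ^+ 2 - h ^+ 2)); first by ring.
by rewrite e mulr1.
Qed.

Lemma branch_conic p r x : 0 < p -> 1 <= x -> conic p r x (branch p r x).
Proof.
move=> p0 x1; have := conic_hyperbola p r (sinh_ofP p0 x1).
by rewrite /branch; set h := sinh_of p x; rewrite /conic => <-; ring.
Qed.

(** For x = c + p h the two arguments are c - r h and c + q h; the next face, with the same r at the
    common edge, has the parameters c and - h. *)
Lemma branch_conic2 p r q x : 0 < p -> 1 <= x ->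
  conic r q (branch p r x) (branch p (- q) x).
Proof.
move=> p0 x1.
have e : (x - p * sinh_of p x) ^+ 2 - (- sinh_of p x) ^+ 2 = 1 by rewrite sqrrN sinh_ofP.
have := conic_hyperbola r q e.
by rewrite /branch; set h := sinh_of p x; rewrite /conic => <-; ring.
Qed.

Lemma branch_id p x : branch p (- p) x = x.
Proof. by rewrite /branch subrr mul0r subr0. Qed.

Lemma branch1 p r : branch p r 1 = 1.
Proof. by rewrite /branch /sinh_of expr1n subrr mul0r mulr0 subr0. Qed.

Lemma conicC p r x y : conic p r x y -> conic r p y x.
Proof. by rewrite /conic (addrC r) => <-; ring. Qed.

Lemma branch_continuous p r x : 0 < p -> 0 < x -> {for x, continuous (branch p r)}.
Proof.
move=> p0 x0.
have cid : {for x, continuous (fun y : R => y)} by exact: cvg_id.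
have csq : {for x, continuous (fun y : R => y ^+ 2)} by exact: continuousM.
have ccst c : {for x, continuous (fun _ : R => c)} by exact: cst_continuous.
have cD (f g : R -> R) : {for x, continuous f} -> {for x, continuous g} ->
  {for x, continuous (fun y : R => f y + g y : R)}.
  exact: continuousD.
have cM (f g : R -> R) : {for x, continuous f} -> {for x, continuous g} ->
  {for x, continuous (fun y : R => f y * g y : R)}.
  exact: continuousM.
have Dn : p * x + Num.sqrt (x ^+ 2 + p ^+ 2 - 1) != 0.
  by rewrite gt_eqF // ltr_wpDr ?sqrtr_ge0 ?mulr_gt0.
have cs : {for x, continuous (fun y => Num.sqrt (y ^+ 2 + p ^+ 2 - 1))}.
  apply: (@continuous_comp _ _ _ (fun y : R => y ^+ 2 + p ^+ 2 - 1) Num.sqrt);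
    last exact: sqrt_continuous.
  by apply: (cD (fun y => y ^+ 2 + p ^+ 2) (fun=> -1)) => //;
    exact: (cD (fun y => y ^+ 2) (fun=> p ^+ 2)).
have cden : {for x, continuous (fun y => (p * y + Num.sqrt (y ^+ 2 + p ^+ 2 - 1))^-1)}.
  apply: continuousV => //; apply: (cD (fun y => p * y)) => //.
  exact: (cM (fun=> p) (fun y => y)).
have ch : {for x, continuous (sinh_of p)}.
  by apply: (cM (fun y => y ^+ 2 - 1) _ _ cden); exact: (cD (fun y => y ^+ 2) (fun=> -1)).
have cr : {for x, continuous (fun y => (p + r) * sinh_of p y)}.
  exact: (cM (fun=> p + r) (sinh_of p)).
by apply: (cD (fun y => y) (fun y => - ((p + r) * sinh_of p y))) => //;
  exact: continuousN cr.
Qed.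

Lemma continuous_lin (T : topologicalType) (x y : T -> R) (s : T) (c e : R) :
  {for s, continuous x} -> {for s, continuous y} ->
  {for s, continuous (fun t => c * x t + e * y t)}.
Proof.
move=> cx cy.
apply: (@continuousD _ _ _ (fun t => c * x t) (fun t => e * y t)).
  by apply: (@continuousM _ _ (fun=> c) x) => //; exact: cst_continuous.
by apply: (@continuousM _ _ (fun=> e) y) => //; exact: cst_continuous.
Qed.

(** At x = y = 1 the two linear forms are p (p + r) and r (p + r), so all inequalities are strict
    there and persist nearby. *)
Lemma near_admissible p r (x y : R -> R) : 0 < p -> 0 < r ->
  {for (1 : R), continuous x} -> {for (1 : R), continuous y} -> x 1 = 1 -> y 1 = 1 ->
  \forall t \near (1 : R), conic p r (x t) (y t) -> admissible p r (x t) (y t).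
Proof.
move=> p0 r0 cx cy x1 y1.
have pos (f : R -> R) : {for (1 : R), continuous f} -> 0 < f 1 ->
  \forall t \near (1 : R), 0 < f t.
  by move=> cf f1; exact: cvgr_gt cf _ f1.
have h1 : \forall t \near (1 : R), 0 < x t by apply: pos; rewrite ?x1.
have h2 : \forall t \near (1 : R), 0 < y t by apply: pos; rewrite ?y1.
have h3 : \forall t \near (1 : R), 0 < (p * r + 1) * x t + (p ^+ 2 - 1) * y t.
  apply: (pos (fun t => (p * r + 1) * x t + (p ^+ 2 - 1) * y t));
    first exact: continuous_lin.
  rewrite x1 y1 (_ : _ + _ = p * (p + r)); last by ring.
  by rewrite mulr_gt0 ?addr_gt0.
have h4 : \forall t \near (1 : R), 0 < (r ^+ 2 - 1) * x t + (p * r + 1) * y t.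
  apply: (pos (fun t => (r ^+ 2 - 1) * x t + (p * r + 1) * y t));
    first exact: continuous_lin.
  rewrite x1 y1 (_ : _ + _ = r * (p + r)); last by ring.
  by rewrite mulr_gt0 ?addr_gt0.
near=> t; move=> C; split=> //; near: t; [exact: h1 | exact: h2 | exact: h3 | exact: h4].
Unshelve. all: by end_near. Qed.

End Curve.

(** * Faces *)

Section Plane.
Variables (R : realType) (d : nat).
Local Notation point := 'rV[R]_d.
Implicit Types O A B C D u v w : point.

Lemma dotvC u v : dotv u v = dotv v u.
Proof. by apply: eq_bigr => k _; rewrite mulrC. Qed.

Lemma dotvDl u v w : dotv (u + v) w = dotv u w + dotv v w.
Proof. by rewrite -big_split; apply: eq_bigr => k _; rewrite mxE mulrDl. Qed.

Lemma dotvZl (a : R) u v : dotv (a *: u) v = a * dotv u v.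
Proof. by rewrite /dotv mulr_sumr; apply: eq_bigr => k _; rewrite mxE mulrA. Qed.

Lemma dotvDr u v w : dotv w (u + v) = dotv w u + dotv w v.
Proof. by rewrite dotvC dotvDl !(dotvC w). Qed.

Lemma dotvZr (a : R) u v : dotv v (a *: u) = a * dotv v u.
Proof. by rewrite dotvC dotvZl (dotvC v). Qed.

Lemma dotvNl u v : dotv (- u) v = - dotv u v.
Proof. by rewrite -scaleN1r dotvZl mulN1r. Qed.

Lemma dotvNr u v : dotv v (- u) = - dotv v u.
Proof. by rewrite dotvC dotvNl dotvC. Qed.

Lemma dotv_ge0 u : 0 <= dotv u u.
Proof. by apply: sumr_ge0 => k _; rewrite -expr2 sqr_ge0. Qed.

Lemma dotv_eq0 u : (dotv u u == 0) = (u == 0).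
Proof.
apply/eqP/eqP => [uu|->]; last by apply: big1 => k _; rewrite mxE mul0r.
apply/rowP => k; rewrite mxE; apply/eqP; rewrite -sqrf_eq0 expr2.
by apply/eqP; apply: (psumr_eq0P _ uu) => // i _; exact: sqr_ge0.
Qed.

(** * Gram determinants, collinearity and affine frames *)

Definition gram u v : R := dotv u u * dotv v v - dotv u v ^+ 2.

Lemma gram_lin (a b c e : R) u v :
  gram (a *: u + b *: v) (c *: u + e *: v) = (a * e - b * c) ^+ 2 * gram u v.
Proof.
by rewrite /gram !(dotvDl, dotvDr, dotvZl, dotvZr) (dotvC v u); ring.
Qed.

Lemma gram0v v : gram 0 v = 0.
Proof. by rewrite /gram -(scale0r (0 : point)) !dotvZl !mul0r expr0n subrr. Qed.

Lemma gramuZ u (k : R) : gram u (k *: u) = 0.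
Proof. by rewrite /gram !(dotvZl, dotvZr); ring. Qed.

(** The vector is |u|^2 times the component of v orthogonal to u; its length yields the
    Cauchy-Schwarz inequality with the case of equality. *)
Lemma gram_residual u v :
  dotv (dotv u u *: v - dotv u v *: u) (dotv u u *: v - dotv u v *: u) =
  dotv u u * gram u v.
Proof.
by rewrite /gram !(dotvDl, dotvDr, dotvNl, dotvNr, dotvZl, dotvZr) (dotvC v u); ring.
Qed.

Lemma gram_ge0 u v : 0 <= gram u v.
Proof.
have [->|u0] := eqVneq u 0; first by rewrite gram0v.
have uu : 0 < dotv u u by rewrite lt_def dotv_eq0 u0 dotv_ge0.
by rewrite -(pmulr_rge0 _ uu) -gram_residual dotv_ge0.
Qed.

Lemma gram_eq0P u v : gram u v = 0 <-> u = 0 \/ exists k, v = k *: u.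
Proof.
split=> [g0|[->|[k ->]]]; [|exact: gram0v|exact: gramuZ].
have [->|u0] := eqVneq u 0; [by left|right].
have := gram_residual u v; rewrite g0 mulr0 => /eqP; rewrite dotv_eq0 subr_eq0 => /eqP e.
exists ((dotv u u)^-1 * dotv u v).
by rewrite -scalerA -e scalerA mulVf ?scale1r // dotv_eq0.
Qed.

Lemma collinearP A B C : collinear A B C <-> gram (B - A) (C - A) = 0.
Proof.
rewrite gram_eq0P /collinear; move: (B - A) (C - A) => u v.
split=> [rk|[->|[k ->]]].
- have [->|u0] := eqVneq u 0; [by left|right].
  have uM : (u <= col_mx u v)%MS by rewrite -addsmxE addsmxSl.
  have := geq_leqif (mxrank_leqif_sup uM); rewrite rank_rV u0 rk => /esym.
  by rewrite col_mx_sub => /andP[_ /sub_rVP].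
- apply: leq_trans (rank_leq_row v); apply: mxrankS.
  by rewrite col_mx_sub sub0mx submx_refl.
- apply: leq_trans (rank_leq_row u); apply: mxrankS.
  by rewrite col_mx_sub submx_refl scalemx_sub.
Qed.

Lemma noncollinearP A B C : ~ collinear A B C <-> 0 < gram (B - A) (C - A).
Proof. by rewrite collinearP lt_def gram_ge0 andbT; split=> [/eqP|/eqP]. Qed.

Lemma gram_indep u v (a b : R) : 0 < gram u v -> a *: u + b *: v = 0 -> a = 0 /\ b = 0.
Proof.
move=> g0 e.
have E1 : gram (a *: u + b *: v) (0 *: u + 1 *: v) = 0 by rewrite e gram0v.
have E2 : gram (a *: u + b *: v) (1 *: u + 0 *: v) = 0 by rewrite e gram0v.
have sq x : x ^+ 2 * gram u v = 0 -> x = 0.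
  by move/eqP; rewrite mulf_eq0 (gt_eqF g0) orbF sqrf_eq0 => /eqP.
move: E1 E2; rewrite !gram_lin => /sq + /sq.
by rewrite !(mulr0, mulr1, sub0r, subr0) => -> /eqP; rewrite oppr_eq0 => /eqP.
Qed.

Lemma lin_inj u v (a b a' b' : R) : 0 < gram u v ->
  a *: u + b *: v = a' *: u + b' *: v -> a = a' /\ b = b'.
Proof.
move=> g0 /eqP; rewrite -subr_eq0 => /eqP e.
have [] : a - a' = 0 /\ b - b' = 0.
  by apply: gram_indep g0 _; rewrite -[RHS]e !scalerBl opprD addrACA.
by move=> /eqP + /eqP; rewrite !subr_eq0 => /eqP + /eqP.
Qed.

Lemma tri_areaE A B C : tri_area A B C = Num.sqrt (gram (B - A) (C - A)) / 2.
Proof. by []. Qed.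

(* Points in the affine coordinates of the frame (O; u, v). *)
Definition pt O u v (a b : R) : point := O + (a *: u + b *: v).

Lemma ptB O u v a b a' b' :
  pt O u v a b - pt O u v a' b' = (a - a') *: u + (b - b') *: v.
Proof. by rewrite /pt opprD addrACA subrr add0r opprD addrACA !scalerBl. Qed.

Lemma tri_area_pt O u v a b a' b' a'' b'' :
  tri_area (pt O u v a b) (pt O u v a' b') (pt O u v a'' b'') =
  `|(a' - a) * (b'' - b) - (b' - b) * (a'' - a)| * (Num.sqrt (gram u v) / 2).
Proof.
by rewrite tri_areaE !ptB gram_lin sqrtrM ?sqr_ge0 // sqrtr_sqr mulrA.
Qed.

Lemma noncollinear_pt O u v a b a' b' a'' b'' : 0 < gram u v ->
  ~ collinear (pt O u v a b) (pt O u v a' b') (pt O u v a'' b'') <->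
  (a' - a) * (b'' - b) - (b' - b) * (a'' - a) != 0.
Proof.
move=> g0; rewrite noncollinearP !ptB gram_lin (pmulr_lgt0 _ g0).
by rewrite lt_def sqr_ge0 andbT sqrf_eq0.
Qed.

Lemma pt_inj O u v a b a' b' : 0 < gram u v ->
  pt O u v a b = pt O u v a' b' -> a = a' /\ b = b'.
Proof. by move=> g0 /addrI; exact: lin_inj. Qed.

Lemma pt_comb O u v (a b a' b' s : R) :
  (1 - s) *: pt O u v a b + s *: pt O u v a' b' =
  pt O u v ((1 - s) * a + s * a') ((1 - s) * b + s * b').
Proof.
rewrite /pt !scalerDr addrACA -scalerDl subrK scale1r; congr (_ + _).
by rewrite !scalerA addrACA -!scalerDl.
Qed.

Lemma pt00 O u v : pt O u v 0 0 = O.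
Proof. by rewrite /pt !scale0r !addr0. Qed.

Lemma pt10 O A v : pt O (A - O) v 1 0 = A.
Proof. by rewrite /pt scale0r addr0 scale1r addrC subrK. Qed.

Lemma pt01 O u B : pt O u (B - O) 0 1 = B.
Proof. by rewrite /pt scale0r add0r scale1r addrC subrK. Qed.

Lemma segC A B : seg A B = seg B A.
Proof.
by apply/seteqP; split=> x [t /andP[t0 t1] ->]; exists (1 - t);
  rewrite ?subKr 1?addrC //; apply/andP; split; lra.
Qed.

Lemma convex_quad_rot A B C D : convex_quad A B C D -> convex_quad B C D A.
Proof. by case=> ? ? ? ? I; split=> //; rewrite setIC segC. Qed.

Lemma collinear_swap A B C : collinear A B C <-> collinear C B A.
Proof.
rewrite !collinearP; have -> : gram (B - C) (A - C) = gram (B - A) (C - A) => //.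
have -> : B - C = 1 *: (B - A) + (-1) *: (C - A).
  by rewrite scale1r scaleN1r opprB addrA subrK.
have -> : A - C = 0 *: (B - A) + (-1) *: (C - A).
  by rewrite scale0r add0r scaleN1r opprB.
by rewrite gram_lin; ring.
Qed.

Lemma convex_quad_rev A B C D : convex_quad A B C D -> convex_quad A D C B.
Proof.
case=> ? ? ? ? [x [xAC xBD]]; split.
- by rewrite collinear_swap.
- by rewrite collinear_swap.
- by rewrite collinear_swap.
- by rewrite collinear_swap.
- by exists x; split=> //; rewrite segC.
Qed.

(** The last inequality puts the vertex (c, e) beyond the line through (x, 0) and (0, y), so that
    the diagonals cross. *)
Lemma convex_quad_pt O u v (x y c e : R) : 0 < gram u v ->
  0 < x -> 0 < y -> 0 < c -> 0 < e -> 0 < c * y + e * x - x * y ->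
  convex_quad (pt O u v 0 0) (pt O u v x 0) (pt O u v c e) (pt O u v 0 y).
Proof.
move=> g0 x0 y0 c0 e0 s0.
have D0 : c * y + e * x != 0 by rewrite gt_eqF ?addr_gt0 ?mulr_gt0.
split.
- apply/noncollinear_pt => //; rewrite !subr0 mul0r subr0.
  by rewrite mulf_neq0 ?gt_eqF.
- apply/noncollinear_pt => //.
  by have -> : (c - x) * (y - 0) - (e - 0) * (0 - x) = c * y + e * x - x * y;
    [ring | rewrite gt_eqF].
- apply/noncollinear_pt => //.
  by have -> : (0 - c) * (0 - e) - (y - e) * (0 - c) = c * y;
    [ring | rewrite mulf_neq0 ?gt_eqF].
- apply/noncollinear_pt => //.
  by have -> : (0 - 0) * (0 - y) - (0 - y) * (x - 0) = x * y;
    [ring | rewrite mulf_neq0 ?gt_eqF].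
- exists (pt O u v (x * y / (c * y + e * x) * c) (x * y / (c * y + e * x) * e)); split.
    exists (x * y / (c * y + e * x)); last first.
      by rewrite pt_comb !mulr0 !add0r.
    apply/andP; split; first by rewrite ltW ?divr_gt0 ?addr_gt0 ?mulr_gt0.
    by rewrite ler_pdivrMr ?addr_gt0 ?mulr_gt0 // mul1r -subr_ge0 ltW.
  exists (e * x / (c * y + e * x)); last first.
    by rewrite pt_comb !mulr0 add0r addr0; congr (pt _ _ _ _ _); field.
  apply/andP; split; first by rewrite ltW ?divr_gt0 ?addr_gt0 ?mulr_gt0.
  by rewrite ler_pdivrMr ?addr_gt0 ?mulr_gt0 // mul1r lerDr ltW ?mulr_gt0.
Qed.

(** [fratio p r] and [fratio r p] are the coordinates of the far vertex; their sum is p r + 1 and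
    their quotient p / r. *)
Definition fratio (p r : R) : R := (p * r + 1) / (p + r) * p.

(* The normal form of a face with vertices O, A, C, B in which p and r are the
   inverse square roots of the opposite ratios with respect to OA and OB. *)
Definition corner (p r : R) O A C B : Prop :=
  [/\ 0 < p, 0 < r, 0 < gram (A - O) (B - O) &
      C = pt O (A - O) (B - O) (fratio p r) (fratio r p)].

Lemma corner_frame p r O A C B : corner p r O A C B ->
  exists o u v, [/\ 0 < gram u v, O = pt o u v 0 0, A = pt o u v 1 0,
    B = pt o u v 0 1 & C = pt o u v (fratio p r) (fratio r p)].
Proof.
by case=> p0 r0 g0 ->; exists O, (A - O), (B - O); rewrite pt00 pt10 pt01.
Qed.

Lemma fratio_gt0 p r : 0 < p -> 0 < r -> 0 < fratio p r.
Proof. by move=> p0 r0; rewrite /fratio !mulr_gt0 ?invr_gt0 ?addr_gt0 ?mulr_gt0. Qed.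

Lemma fratioD p r : 0 < p -> 0 < r -> fratio p r + fratio r p = p * r + 1.
Proof.
move=> p0 r0; have D0 : p + r != 0 by rewrite gt_eqF ?addr_gt0.
have D0' : r + p != 0 by rewrite addrC.
by rewrite /fratio; field; rewrite ?D0 ?D0'.
Qed.

Lemma gramC u v : gram u v = gram v u.
Proof. by rewrite /gram (dotvC u v) mulrC. Qed.

Lemma ptC O u v a b : pt O u v a b = pt O v u b a.
Proof. by rewrite /pt [X in _ + X]addrC. Qed.

Lemma cornerC p r O A C B : corner p r O A C B -> corner r p O B C A.
Proof. by case=> p0 r0 g0 ->; split=> //; rewrite 1?gramC // ptC. Qed.

Lemma corner_inj p r p' r' : 0 < p -> 0 < r -> 0 < p' -> 0 < r' ->
  fratio p r = fratio p' r' -> fratio r p = fratio r' p' -> p = p' /\ r = r'.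
Proof.
move=> p0 r0 p0' r0' e1 e2.
have sq s t : 0 < s -> 0 < t -> s ^+ 2 =
  (fratio s t + fratio t s - 1) * fratio s t / fratio t s.
  move=> s0 t0; rewrite fratioD // /fratio [t + s]addrC [t * s]mulrC.
  by field; rewrite !gt_eqF ?addr_gt0 ?mulr_gt0.
split; apply/eqP; rewrite -(@eqrXn2 _ 2) ?ltW //; apply/eqP.
  by rewrite (sq p r) // (sq p' r') // e1 e2.
by rewrite (sq r p) // (sq r' p') // e1 e2.
Qed.

Lemma convex_quad_corner O A C B : convex_quad O A C B -> exists p r, corner p r O A C B.
Proof.
case=> OAC ACB CBO BOA [x [[s /andP[s0 s1] xs] [t /andP[t0 t1] xt]]].
have [u [v [uE vE]]] : exists u v, u = A - O /\ v = B - O by exists (A - O), (B - O).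
have g0 : 0 < gram u v.
  move/noncollinearP: BOA; have -> : O - B = 0 *: u + (-1) *: v.
    by rewrite scale0r add0r scaleN1r vE opprB.
  have -> : A - B = 1 *: u + (-1) *: v.
    by rewrite scale1r scaleN1r uE vE opprB addrA subrK.
  by rewrite gram_lin (_ : _ ^+ 2 = 1) ?mul1r //; ring.
have AE : A = pt O u v 1 0 by rewrite uE pt10.
have BE : B = pt O u v 0 1 by rewrite vE pt01.
have OE : O = pt O u v 0 0 by rewrite pt00.
have xE : x = pt O u v (1 - t) t.
  by rewrite xt AE BE pt_comb !(mulr0, mulr1) addr0 add0r.
have sC : s *: (C - O) = (1 - t) *: u + t *: v.
  apply: (addrI O); rewrite -[RHS]/(pt O u v (1 - t) t) -xE xs scalerBl scale1r.
  by rewrite scalerBr addrA addrAC.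
(* If s were 0, the diagonals would meet at O, which is not on the line AB. *)
have s_neq0 : s != 0.
  apply: contraTneq g0 => sz; rewrite sz scale0r in sC.
  apply/negP => g0; have [e1 e2] := gram_indep g0 (esym sC).
  by move: e1; rewrite e2 subr0 => /eqP; rewrite oner_eq0.
have s_gt0 : 0 < s by rewrite lt_def s_neq0.
pose a := (1 - t) / s; pose b := t / s.
have CE : C = pt O u v a b.
  apply: (addIr (- O)); rewrite /pt addrAC subrr add0r /a /b.
  by rewrite ![_ / s]mulrC -!scalerA -scalerDr -sC scalerA mulVf ?scale1r.
have ab1 : a + b = s^-1 by rewrite /a /b -mulrDl subrK mul1r.
have a_ge0 : 0 <= a by rewrite divr_ge0 // subr_ge0.
have b_ge0 : 0 <= b by rewrite divr_ge0.
have b0 : 0 < b.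
  rewrite lt_def b_ge0 andbT; move: OAC; rewrite {1}OE AE CE noncollinear_pt //.
  by rewrite !subr0 mul0r subr0 mul1r.
have a0 : 0 < a.
  rewrite lt_def a_ge0 andbT; move: CBO; rewrite {1}OE BE CE noncollinear_pt //.
  by rewrite (_ : _ - _ = a); last by ring.
have ab : 0 < a + b - 1.
  rewrite lt_def subr_ge0 ab1 invf_ge1 // s1 andbT -ab1.
  move: ACB; rewrite AE BE CE noncollinear_pt //.
  by rewrite (_ : _ - _ = a + b - 1); last by ring.
move: a b CE ab1 a_ge0 b_ge0 b0 a0 ab => a b CE _ _ _ b0 a0 ab.
pose q := a + b - 1; have q0 : 0 < q := ab.
(* The solution of p r = a + b - 1 and p / r = a / b. *)
exists (Num.sqrt (q * a / b)), (Num.sqrt (q * b / a)).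
set p := Num.sqrt _; set r := Num.sqrt _.
have p0 : 0 < p by rewrite sqrtr_gt0 divr_gt0 ?mulr_gt0.
have r0 : 0 < r by rewrite sqrtr_gt0 divr_gt0 ?mulr_gt0.
have an0 : a != 0 by rewrite gt_eqF.
have bn0 : b != 0 by rewrite gt_eqF.
have prE : p * r = q.
  have e : q * a / b * (q * b / a) = q ^+ 2 by field; rewrite an0 bn0.
  by rewrite /p /r -sqrtrM ?divr_ge0 ?mulr_ge0 ?ltW // e sqrtr_sqr ger0_norm ?ltW.
have rpE : a * r = b * p.
  apply/eqP; rewrite -(@eqrXn2 _ 2) ?mulr_ge0 ?ltW // !exprMn.
  rewrite !sqr_sqrtr ?divr_ge0 ?mulr_ge0 ?ltW //; apply/eqP.
  by field; rewrite an0 bn0.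
have D0 : p + r != 0 by rewrite gt_eqF ?addr_gt0.
have D0' : r + p != 0 by rewrite addrC.
have fa : fratio p r = a.
  apply: (mulIf D0); rewrite /fratio prE mulrAC divfK // /q subrK mulrDr rpE mulrC.
  by ring.
have fb : fratio r p = b.
  apply: (mulIf D0'); rewrite /fratio (mulrC r) prE mulrAC divfK // /q subrK mulrDr -rpE.
  by ring.
by split=> //; rewrite -uE -vE // CE fa fb.
Qed.

Lemma quad_area_pt O u v (x y c e : R) : 0 < x -> 0 < y -> 0 < c -> 0 < e ->
  quad_area (pt O u v 0 0) (pt O u v x 0) (pt O u v c e) (pt O u v 0 y) =
  (c * y + e * x) * (Num.sqrt (gram u v) / 2).
Proof.
move=> x0 y0 c0 e0; rewrite /quad_area !tri_area_pt -mulrDl !subr0; congr (_ * _).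
rewrite mul0r subr0 mulr0 subr0 !ger0_norm ?mulr_ge0 ?ltW //; ring.
Qed.

Lemma tri_areaC A B C : tri_area A B C = tri_area A C B.
Proof. by rewrite !tri_areaE gramC. Qed.

Lemma tri_area_swap A B C : tri_area A B C = tri_area C B A.
Proof.
rewrite !tri_areaE; congr (Num.sqrt _ / _).
have -> : B - C = 1 *: (B - A) + (-1) *: (C - A).
  by rewrite scale1r scaleN1r opprB addrA subrK.
have -> : A - C = 0 *: (B - A) + (-1) *: (C - A).
  by rewrite scale0r add0r scaleN1r opprB.
by rewrite gram_lin; ring.
Qed.

Lemma quad_area_rev A B C D : quad_area A D C B = quad_area A B C D.
Proof. by rewrite /quad_area addrC tri_areaC (tri_areaC A D). Qed.

(** [quad_area] cuts along the diagonal through its first vertex, so rotating the labels switches to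
    the other diagonal; the sums agree by convexity. *)
Lemma quad_area_rot A B C D : convex_quad A B C D ->
  quad_area B C D A = quad_area A B C D.
Proof.
move=> /convex_quad_corner[p [r cor]]; have [p0 r0 _ _] := cor.
have [K [u [v [g0 -> -> -> ->]]]] := corner_frame cor.
have D0 := fratioD p0 r0; have a0 := fratio_gt0 p0 r0; have b0 := fratio_gt0 r0 p0.
rewrite quad_area_pt // /quad_area !tri_area_pt -mulrDl; congr (_ * _).
have -> : (fratio p r - 1) * (1 - 0) - (fratio r p - 0) * (0 - 1) = p * r.
  by apply: (addIr 1); rewrite -D0; ring.
have -> : (0 - 1) * (0 - 0) - (1 - 0) * (0 - 1) = 1 :> R by ring.
by rewrite normr1 gtr0_norm ?mulr_gt0 // !mulr1.
Qed.

Lemma diagonals_pt O u v (c e : R) Q : 0 < gram u v -> 0 < c -> 0 < e -> 1 < c + e ->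
  (seg (pt O u v 0 0) (pt O u v c e) `&` seg (pt O u v 1 0) (pt O u v 0 1)) Q <->
  Q = pt O u v (c / (c + e)) (e / (c + e)).
Proof.
move=> g0 c0 e0 ce; have D0 : 0 < c + e by rewrite addr_gt0.
have D1 : c + e != 0 by rewrite gt_eqF.
split=> [[[s _ Qs] [t _ Qt]]|->].
  move: Qs; rewrite Qt !pt_comb => /(pt_inj g0)[].
  rewrite !(mulr0, mulr1, addr0, add0r) => e1 e2.
  have sE : s = (c + e)^-1.
    by apply: (mulIf D1); rewrite mulVf // mulrDr -e1 -e2 subrK.
  by rewrite e1 e2 sE ![_^-1 * _]mulrC.
split.
  exists (c + e)^-1; last by rewrite pt_comb !mulr0 !add0r ![_^-1 * _]mulrC.
  apply/andP; split; first by rewrite invr_ge0 ltW.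
  by rewrite invf_le1 // ltW.
exists (e / (c + e)).
  apply/andP; split; first by rewrite ltW ?divr_gt0.
  by rewrite ler_pdivrMr // mul1r lerDr ltW.
by rewrite pt_comb; congr (pt _ _ _ _ _); field.
Qed.

Lemma diag_pointP A B C D Q : (forall x, (seg A C `&` seg B D) x <-> x = Q) ->
  diag_point A B C D = Q.
Proof.
move=> H; apply: xget_subset1; first exact/H.
by move=> x y /H -> /H ->.
Qed.

(** Both orders of the side occur, since [adjacent_faces] lists one common edge towards the centre
    and the other away from it. *)
Lemma opposite_ratio_corner (p r : R) O A C B : corner p r O A C B ->
  opposite_ratio O A C B = p ^- 2 /\ opposite_ratio A O B C = p ^- 2.
Proof.
move=> cor; have [p0 r0 _ _] := cor.
have [K [u [v [g0 -> -> -> ->]]]] := corner_frame cor.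
have [c cE] : exists c, c = fratio p r by exists (fratio p r).
have [e eE] : exists e, e = fratio r p by exists (fratio r p).
rewrite -cE -eE; have c0 : 0 < c by rewrite cE fratio_gt0.
have e0 : 0 < e by rewrite eE fratio_gt0.
have ceE : c + e = p * r + 1 by rewrite cE eE fratioD.
have ce : 1 < c + e by rewrite ceE ltrDr mulr_gt0.
pose Q := pt K u v (c / (c + e)) (e / (c + e)).
have D Q' := diagonals_pt K Q' g0 c0 e0 ce.
have D1 : diag_point (pt K u v 0 0) (pt K u v 1 0) (pt K u v c e) (pt K u v 0 1) = Q.
  exact: diag_pointP.
have D2 : diag_point (pt K u v 1 0) (pt K u v 0 0) (pt K u v 0 1) (pt K u v c e) = Q.
  by apply: diag_pointP => x; rewrite setIC.
have G0 : Num.sqrt (gram u v) / 2 != 0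
  by rewrite mulf_neq0 ?invr_eq0 ?pnatr_eq0 // gt_eqF ?sqrtr_gt0.
have ce0 : c + e != 0 by rewrite gt_eqF ?addr_gt0.
have main : tri_area (pt K u v 0 0) Q (pt K u v 1 0) /
            tri_area (pt K u v c e) Q (pt K u v 0 1) = p ^- 2.
  rewrite /Q !tri_area_pt -mulf_div divff // mulr1.
  have -> : (c / (c + e) - 0) * (0 - 0) - (e / (c + e) - 0) * (1 - 0) =
    - (e / (c + e)) by ring.
  have -> : (c / (c + e) - c) * (1 - e) - (e / (c + e) - e) * (0 - c) =
    - (c * (c + e - 1) / (c + e)) by field.
  rewrite !normrN ceE addrK !ger0_norm ?divr_ge0 ?mulr_ge0 ?addr_ge0 ?mulr_ge0 ?ltW //.
  rewrite cE eE /fratio [r + p]addrC [r * p]mulrC.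
  by field; rewrite !gt_eqF ?addr_gt0 ?mulr_gt0.
split; first by rewrite /opposite_ratio D1.
by rewrite /opposite_ratio D2 tri_area_swap (tri_area_swap (pt K u v 0 1)).
Qed.

(** The inequalities are the half-planes of the sides OB, OA, AC and BC, in this order, for A = (1,
    0), C = (c, e) and B = (0, 1). They replace an argument about extreme points when a face is
    given only as a set. *)
Lemma quad_pt O u v (c e : R) x : 0 < c -> 0 < e -> 1 < c + e ->
  quad (pt O u v 0 0) (pt O u v 1 0) (pt O u v c e) (pt O u v 0 1) x ->
  exists a b, [/\ x = pt O u v a b, 0 <= a, 0 <= b, e * (a - 1) <= (c - 1) * b &
    c * (b - 1) <= (e - 1) * a].
Proof.
move=> c0 e0 ce [w0 [w1 [w2 [w3 [[h0 h1 h2 h3 hs] ->]]]]].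
exists (w1 + w2 * c), (w2 * e + w3).
have hs0 : w0 = 1 - w1 - w2 - w3 by rewrite -hs; ring.
split.
- by apply/rowP => k; rewrite /pt !mxE hs0; ring.
- by rewrite addr_ge0 ?mulr_ge0 // ltW.
- by rewrite addr_ge0 ?mulr_ge0 // ltW.
- rewrite -subr_ge0.
  have -> : (c - 1) * (w2 * e + w3) - e * (w1 + w2 * c - 1) = e * w0 + w3 * (c + e - 1).
    by rewrite hs0; ring.
  by rewrite addr_ge0 ?mulr_ge0 ?subr_ge0 // ltW.
- rewrite -subr_ge0.
  have -> : (e - 1) * (w1 + w2 * c) - c * (w2 * e + w3 - 1) = c * w0 + w1 * (c + e - 1).
    by rewrite hs0; ring.
  by rewrite addr_ge0 ?mulr_ge0 ?subr_ge0 // ltW.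
Qed.

Lemma fix_plane u v v' : 0 < gram u v -> exists M : 'M[R]_d, u *m M = u /\ v *m M = v'.
Proof.
move=> g0; have nc : ~ collinear 0 u v by apply/noncollinearP; rewrite !subr0.
have uv : row_free (col_mx u v).
  rewrite /row_free eqn_leq rank_leq_row /= ltnNge; apply/negP => rk.
  by apply: nc; rewrite /collinear !subr0.
exists (pinvmx (col_mx u v) *m col_mx u v').
by apply: eq_col_mx; rewrite -mul_col_mx mulmxA mulmxVp // mul1mx.
Qed.

Lemma affine_comb (f : point -> point) (a b c e : R) A B C D : affine_map f ->
  a + b + c + e = 1 ->
  f (a *: A + b *: B + c *: C + e *: D) = a *: f A + b *: f B + c *: f C + e *: f D.
Proof.
move=> [M [b0 fE]] s1; rewrite !fE !mulmxDl -!scalemxAl !scalerDr.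
rewrite -[in LHS](scale1r b0) -s1 !scalerDl.
by apply/rowP => k; rewrite !mxE; ring.
Qed.

(** An affine map fixing O and A can still send B anywhere off the line OA, so equal coordinates of
    the far vertices suffice. Conversely, the faces agree only as sets, and f B = B' has to be
    deduced from the half-planes of [quad_pt]. *)
Lemma affine_symmetric_corner (p r p' r' : R) O A C B C' B' :
  corner p r O A C B -> corner p' r' O A C' B' ->
  affine_symmetric O A C B C' B' <-> p = p' /\ r = r'.
Proof.
move=> cor cor'; have [p0 r0 _ _] := cor; have [p0' r0' _ _] := cor'.
split=> [|[pp rr]]; last first.
  move: cor'; rewrite -pp -rr => cor'.
  have [_ _ g0 CE] := cor; have [_ _ g0' CE'] := cor'.
  have [M [uM vM]] := fix_plane (B' - O) g0.
  pose f x := x *m M + (O - O *m M).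
  have fE x : f x = O + (x - O) *m M by rewrite /f mulmxBl addrCA.
  have fO : f O = O by rewrite fE subrr mul0mx addr0.
  have fA : f A = A by rewrite fE uM addrC subrK.
  have fB : f B = B' by rewrite fE vM addrC subrK.
  have fC : f C = C'.
    rewrite CE fE CE' /pt [X in X *m M]addrC addKr mulmxDl -!scalemxAl uM vM //.
  have aff : affine_map f by exists M, (O - O *m M).
  exists f => //; split.
    move=> x [t _ ->].
    have := affine_comb O A O O aff (_ : (1 - t) + t + 0 + 0 = 1).
    rewrite !scale0r !addr0 fO fA subrK; exact.
  apply/seteqP; split=> [_ [x [w0 [w1 [w2 [w3 [ws ->]]]]] <-]|_
    [w0 [w1 [w2 [w3 [ws ->]]]]]].
    exists w0, w1, w2, w3; split=> //; have [_ _ _ _ s1] := ws.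
    by rewrite affine_comb // fO fA fB fC.
  exists (w0 *: O + w1 *: A + w2 *: C + w3 *: B); first by exists w0, w1, w2, w3.
  by have [_ _ _ _ s1] := ws; rewrite affine_comb // fO fA fB fC.
move=> [f [M [b0 fE]] [fseg fquad]].
have [c cE] : exists c, c = fratio p r by exists (fratio p r).
have [e eE] : exists e, e = fratio r p by exists (fratio r p).
have [c' cE'] : exists c, c = fratio p' r' by exists (fratio p' r').
have [e' eE'] : exists e, e = fratio r' p' by exists (fratio r' p').
have c0 : 0 < c by rewrite cE fratio_gt0.
have e0 : 0 < e by rewrite eE fratio_gt0.
have ce : 1 < c + e by rewrite cE eE fratioD // ltrDr mulr_gt0.
have c0' : 0 < c' by rewrite cE' fratio_gt0.
have e0' : 0 < e' by rewrite eE' fratio_gt0.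
have ce' : 1 < c' + e' by rewrite cE' eE' fratioD // ltrDr mulr_gt0.
suff [e1 e2] : c = c' /\ e = e' by apply: corner_inj; rewrite // -?cE -?eE -?cE' -?eE'.
have [_ _ g0 CE] := cor; have [_ _ g0' CE'] := cor'.
rewrite -cE -eE in CE; rewrite -cE' -eE' in CE'.
have [u [v [v' [uE vE vE']]]] : exists u v v', [/\ u = A - O, v = B - O & v' = B' - O].
  by exists (A - O), (B - O), (B' - O).
rewrite -uE -vE in g0 CE; rewrite -uE -vE' in g0' CE'.
have OE w : O = pt O u w 0 0 by rewrite pt00.
have AE w : A = pt O u w 1 0 by rewrite uE pt10.
have BE : B = pt O u v 0 1 by rewrite vE pt01.
have BE' : B' = pt O u v' 0 1 by rewrite vE' pt01.
have Q x : quad O A C B x -> exists a b, [/\ x = pt O u v a b, 0 <= a, 0 <= b,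
    e * (a - 1) <= (c - 1) * b & c * (b - 1) <= (e - 1) * a].
  by rewrite {1}(OE v) (AE v) CE BE; apply: quad_pt.
have Q' x : quad O A C' B' x -> exists a b, [/\ x = pt O u v' a b, 0 <= a, 0 <= b,
    e' * (a - 1) <= (c' - 1) * b & c' * (b - 1) <= (e' - 1) * a].
  by rewrite {1}(OE v') (AE v') CE' BE'; apply: quad_pt.
have vertB A1 B1 C1 D1 : quad A1 B1 C1 D1 D1.
  exists 0, 0, 0, 1; split; last by rewrite !scale0r !add0r scale1r.
  by split=> //; rewrite ?ler01 // !add0r.
have vertC A1 B1 C1 D1 : quad A1 B1 C1 D1 C1.
  exists 0, 0, 1, 0; split; last by rewrite !scale0r !add0r scale1r addr0.
  by split=> //; rewrite ?ler01 // !add0r addr0.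
have fO : f O = O by apply: fseg; exists 0;
  rewrite ?lexx ?ler01 // subr0 scale1r scale0r addr0.
have fA : f A = A by apply: fseg; exists 1;
  rewrite ?lexx ?ler01 // subrr scale1r scale0r add0r.
have [a1 [b1 [fB a10 b10 _ hB]]] : exists a b, [/\ f B = pt O u v' a b, 0 <= a, 0 <= b,
    e' * (a - 1) <= (c' - 1) * b & c' * (b - 1) <= (e' - 1) * a].
  by apply: Q'; rewrite -fquad; exists B.
have fpt a b : f (pt O u v a b) = pt O u v' (a + b * a1) (b * b1).
  have uM : u *m M = u.
    by rewrite uE mulmxBl -[RHS]/(A - O) -{2}fA -{2}fO !fE opprD addrACA subrr addr0.
  have vM : v *m M = f B - f O by rewrite vE !fE mulmxBl opprD addrACA subrr addr0.
  have -> : f (pt O u v a b) = f O + (a *: u + b *: (f B - f O)).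
    by rewrite -vM -{2}uM !fE /pt !mulmxDl -!scalemxAl addrAC.
  rewrite fO fB /pt; apply/rowP => k; rewrite !mxE; ring.
have [a [b [eB' a0 b0']]] : exists a b,
  [/\ B' = pt O u v' (a + b * a1) (b * b1), 0 <= a, 0 <= b,
    e * (a - 1) <= (c - 1) * b & c * (b - 1) <= (e - 1) * a].
  have := vertB O A C' B'; rewrite -fquad => -[y /Q[a [b [-> ? ? ? ?]]]].
  by rewrite fpt => yE; exists a, b.
(* The coordinates of B' give 0 = a + b a1 and 1 = b b1 with nonnegative terms, so a = a1 = 0. The
   half-planes of BC and B'C' then give b <= 1 and b1 <= 1, hence b1 = 1. *)
move=> _ hb; move: eB'; rewrite BE' => /(pt_inj g0')[eq1 eq2].
have aeq0 : a = 0 by apply/eqP; rewrite eq_le a0 andbT; have := mulr_ge0 b0' a10; lra.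
have bn0 : b != 0 by apply/eqP => bz; move: eq2; rewrite bz mul0r => /eqP;
  rewrite oner_eq0.
have a1eq0 : a1 = 0.
  by apply: (mulfI bn0); rewrite mulr0 -[LHS]add0r -aeq0 -eq1.
have b_le1 : b <= 1.
  by rewrite -subr_le0 -(pmulr_rle0 _ c0) (le_trans hb) // aeq0 mulr0.
have b1_le1 : b1 <= 1.
  by rewrite -subr_le0 -(pmulr_rle0 _ c0') (le_trans hB) // a1eq0 mulr0.
have b1_eq1 : b1 = 1.
  apply/eqP; rewrite eq_le b1_le1 /= [X in X <= _]eq2.
  by rewrite -[X in _ <= X]mul1r ler_wpM2r.
(* Now f preserves coordinates, so each far vertex lies in the other face, and the inequalities of
   both inclusions combine to equalities. *)
have {}fpt x y : f (pt O u v x y) = pt O u v' x y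
  by rewrite fpt a1eq0 b1_eq1 mulr0 addr0 mulr1.
have [x1 [y1 [E1 _ _ I1 I2]]] : exists x y,
  [/\ pt O u v' c e = pt O u v' x y, 0 <= x, 0 <= y,
    e' * (x - 1) <= (c' - 1) * y & c' * (y - 1) <= (e' - 1) * x].
  by apply: Q'; rewrite -fpt -CE -fquad; exists C.
have [x2 [y2 [E2 J1 J2]]] : exists x y, [/\ pt O u v' c' e' = pt O u v' x y,
    e * (x - 1) <= (c - 1) * y & c * (y - 1) <= (e - 1) * x].
  have := vertC O A C' B'; rewrite -fquad => -[y /Q[x2 [y2 [-> ? ? ? ?]]]].
  by rewrite fpt -CE' => yE; exists x2, y2.
have [? ?] := pt_inj g0' E1; have [? ?] := pt_inj g0' E2; subst x1 y1 x2 y2.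
have D1 : e * c' - c * e' = e - e' by lra.
have D2 : c * e' - e * c' = c - c' by lra.
have DE : e - e' = c' - c by lra.
have /eqP : (c + e - 1) * (c' - c) = 0.
  transitivity (e * (c' - c) + c * (e - e') - (e - e')); first by rewrite DE; ring.
  by rewrite -[in X in _ - X]D1; ring.
rewrite mulf_eq0 !subr_eq0 (gt_eqF ce) => /eqP cc; split; lra.
Qed.

Lemma quadC A B C D : quad A B C D = quad B A D C.
Proof.
have sub A1 B1 C1 D1 : quad A1 B1 C1 D1 `<=` quad B1 A1 D1 C1.
  move=> x [a [b [c [e [[? ? ? ? s] ->]]]]]; exists b, a, e, c; split.
    by split=> //; rewrite -s; ring.
  by apply/rowP => k; rewrite !mxE; ring.
by apply/seteqP; split; apply: sub.
Qed.

Lemma affine_symmetricC A B C D E F :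
  affine_symmetric A B C D E F <-> affine_symmetric B A D C F E.
Proof.
have sub A1 B1 C1 D1 E1 F1 :
    affine_symmetric A1 B1 C1 D1 E1 F1 -> affine_symmetric B1 A1 D1 C1 F1 E1.
  case=> f aff [fs fq]; exists f => //; split; first by move=> x; rewrite segC; exact: fs.
  by rewrite quadC fq quadC.
by split; apply: sub.
Qed.

(* The factor by which the edge BC of a face OACB is scaled when OA and OB are
   scaled by x and y. *)
Definition outer (p r x y : R) : R :=
  ((p * r + 1) * x + (p ^+ 2 - 1) * y) / (p * (p + r)).

Definition far_vertex (p r : R) O u v (x y : R) : point :=
  pt O u v (fratio p r * outer p r x y) (fratio r p * outer r p y x).

Lemma outer_gt0 p r x y : 0 < p -> 0 < r -> admissible p r x y -> 0 < outer p r x y.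
Proof. by move=> p0 r0 [_ _ s0 _ _]; rewrite divr_gt0 // mulr_gt0 // addr_gt0. Qed.

Section Corner.
Variables (p r : R) (O A C B : point).
Hypothesis cor : corner p r O A C B.

(** Reaching C' through A' and through B' gives two linear equations for k r and l p with
    determinant (p + r)^2 up to sign. Thus x and y determine the outer factors, and substituting
    them turns equality of areas into the conic. *)
Lemma parallel_corner O' A' C' B' (x y k l : R) :
  0 < x -> 0 < y -> 0 < k -> 0 < l ->
  A' - O' = x *: (A - O) -> B' - O' = y *: (B - O) ->
  C' - A' = k *: (C - A) -> C' - B' = l *: (C - B) ->
  quad_area O' A' C' B' = quad_area O A C B ->
  admissible p r x y /\ C' = far_vertex p r O' (A - O) (B - O) x y.
Proof.
have [p0 r0 _ _] := cor; move=> x0 y0 k0 l0 eA eB eCA eCB area.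
have [K [u [v [g0 OE AE BE CE]]]] := corner_frame cor.
have uE : A - O = u by rewrite AE OE ptB !subr0 scale1r scale0r addr0.
have vE : B - O = v by rewrite BE OE ptB !subr0 scale1r scale0r add0r.
rewrite uE vE in eA eB *.
have A'E : A' = pt O' u v x 0 by rewrite /pt scale0r addr0 -eA addrC subrK.
have B'E : B' = pt O' u v 0 y by rewrite /pt scale0r add0r -eB addrC subrK.
have [c cE] : exists c, c = fratio p r by exists (fratio p r).
have [e eE] : exists e, e = fratio r p by exists (fratio r p).
rewrite -cE -eE in CE.
have C'E1 : C' = pt O' u v (x + k * (c - 1)) (k * e).
  rewrite -[C'](subrK A') eCA A'E CE AE ptB subr0 /pt.
  by apply/rowP => i; rewrite !mxE; ring.
have C'E2 : C' = pt O' u v (l * c) (y + l * (e - 1)).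
  rewrite -[C'](subrK B') eCB B'E CE BE ptB subr0 /pt.
  by apply/rowP => i; rewrite !mxE; ring.
have [E1 E2] : x + k * (c - 1) = l * c /\ k * e = y + l * (e - 1).
  by apply: (pt_inj g0 (O := O')); rewrite -C'E1 -C'E2.
have D0 : 0 < p + r by rewrite addr_gt0.
have Dn : p + r != 0 by rewrite gt_eqF.
have pr0 : 0 < p * r + 1 by rewrite addr_gt0 ?mulr_gt0.
have cD : (p + r) * c = (p * r + 1) * p by rewrite cE /fratio; field.
have eD : (p + r) * e = (p * r + 1) * r
  by rewrite eE /fratio [r + p]addrC [r * p]mulrC; field.
have E1' : (p + r) * x + k * r * (p ^+ 2 - 1) = l * p * (p * r + 1).
  transitivity (l * ((p + r) * c)); last by rewrite cD; ring.
  transitivity ((p + r) * (l * c)); last by ring.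
  rewrite -E1; transitivity ((p + r) * x + k * ((p + r) * c - (p + r))); last by ring.
  by rewrite cD; ring.
have E2' : (p + r) * y + l * p * (r ^+ 2 - 1) = k * r * (p * r + 1).
  transitivity (k * ((p + r) * e)); last by rewrite eD; ring.
  transitivity ((p + r) * (k * e)); last by ring.
  rewrite E2; transitivity ((p + r) * y + l * ((p + r) * e - (p + r))); last by ring.
  by rewrite eD; ring.
have kE : (r ^+ 2 - 1) * x + (p * r + 1) * y = k * r * (p + r).
  apply: (mulfI Dn).
  transitivity ((p * r + 1) * ((p + r) * y + l * p * (r ^+ 2 - 1)) +
    (r ^+ 2 - 1) * ((p + r) * x + k * r * (p ^+ 2 - 1)) -
    (r ^+ 2 - 1) * (l * p * (p * r + 1)) - (r ^+ 2 - 1) * (k * r * (p ^+ 2 - 1)));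
      first by ring.
  by rewrite E1' E2'; ring.
have lE : (p * r + 1) * x + (p ^+ 2 - 1) * y = l * p * (p + r).
  apply: (mulfI Dn).
  transitivity ((p * r + 1) * ((p + r) * x + k * r * (p ^+ 2 - 1)) +
    (p ^+ 2 - 1) * ((p + r) * y + l * p * (r ^+ 2 - 1)) -
    (p ^+ 2 - 1) * (k * r * (p * r + 1)) - (p ^+ 2 - 1) * (l * p * (r ^+ 2 - 1)));
      first by ring.
  by rewrite E1' E2'; ring.
have C'E : C' = pt O' u v (l * c) (k * e) by rewrite C'E2 -E2.
split.
  split=> //; rewrite ?kE ?lE ?mulr_gt0 //.
  have G0 : Num.sqrt (gram u v) / 2 != 0.
    by rewrite mulf_neq0 ?invr_eq0 ?pnatr_eq0 // gt_eqF ?sqrtr_gt0.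
  have c0 : 0 < c by rewrite cE fratio_gt0.
  have e0 : 0 < e by rewrite eE fratio_gt0.
  move: area; rewrite -{1}(pt00 O' u v) A'E B'E C'E OE AE BE CE.
  rewrite !quad_area_pt ?mulr_gt0 // !mulr1 => /(mulIf G0) ar.
  have prn : p * r + 1 != 0 by rewrite gt_eqF.
  apply: (mulfI prn); rewrite /conic.
  transitivity ((p * r + 1) * (((r ^+ 2 - 1) * x + (p * r + 1) * y) * x +
    ((p * r + 1) * x + (p ^+ 2 - 1) * y) * y)); first by ring.
  rewrite kE lE.
  transitivity ((p + r) * (l * y * ((p * r + 1) * p) + k * x * ((p * r + 1) * r)));
    first by ring.
  rewrite -cD -eD; transitivity ((p + r) ^+ 2 * (l * c * y + k * e * x)); first by ring.
  by rewrite ar cE eE fratioD // mulrC.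
rewrite C'E /far_vertex -cE -eE ![_ * outer _ _ _ _]mulrC;
  congr (pt _ _ _ (_ * _) (_ * _)).
  by rewrite /outer lE; field; rewrite Dn gt_eqF.
have -> : outer r p y x = ((r ^+ 2 - 1) * x + (p * r + 1) * y) / (r * (p + r)).
  by rewrite /outer [r * p]mulrC [r + p]addrC [(p * r + 1) * y + _]addrC.
by rewrite kE; field; rewrite Dn gt_eqF.
Qed.

Lemma far_vertexBl x y :
  far_vertex p r O (A - O) (B - O) x y - (O + x *: (A - O)) = outer r p y x *: (C - A).
Proof.
have [p0 r0 _ CE] := cor.
have [u uE] : exists u, u = A - O by exists (A - O).
have [v vE] : exists v, v = B - O by exists (B - O).
have -> : C - A = (fratio p r - 1) *: u + (fratio r p - 0) *: v.
  by rewrite -(ptB O) CE -uE -vE [X in _ = _ - pt _ X _ _ _]uE pt10.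
rewrite -uE -vE.
have -> : O + x *: u = pt O u v x 0 by rewrite /pt scale0r addr0.
rewrite /far_vertex !ptB scalerDr !scalerA; congr (_ *: _ + _ *: _).
  rewrite /fratio /outer [r + p]addrC [r * p]mulrC.
  by field; rewrite !gt_eqF ?addr_gt0.
by rewrite !subr0 mulrC.
Qed.

End Corner.

Lemma far_vertexC p r O u v x y : far_vertex p r O u v x y = far_vertex r p O v u y x.
Proof. exact: ptC. Qed.

Lemma far_vertexBr p r O A C B x y : corner p r O A C B ->
  far_vertex p r O (A - O) (B - O) x y - (O + y *: (B - O)) = outer p r x y *: (C - B).
Proof. by move=> /cornerC cor; rewrite far_vertexC; exact: far_vertexBl. Qed.

Lemma continuous_addZ (T : topologicalType) (f : T -> point) (x : T -> R) (s : T) u :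
  {for s, continuous f} -> {for s, continuous x} ->
  {for s, continuous (fun t => f t + x t *: u)}.
Proof.
move=> cf cx; have cz := @continuousZr_tmp R point T x u s cx.
exact: (@continuousD R point T f (fun t => x t *: u) s cf cz).
Qed.

Lemma continuous_far (T : topologicalType) (x y : T -> R) (s : T) (p r : R)
  (Q u v : point) :
  {for s, continuous x} -> {for s, continuous y} ->
  {for s, continuous (fun t => far_vertex p r Q u v (x t) (y t))}.
Proof.
move=> cx cy.
rewrite [X in {for s, continuous X}](_ : _ = fun t => Q +
  (fratio p r * ((p * r + 1) / (p * (p + r))) * x t +
    fratio p r * ((p ^+ 2 - 1) / (p * (p + r))) * y t) *: u +
  (fratio r p * ((r ^+ 2 - 1) / (r * (r + p))) * x t +
    fratio r p * ((r * p + 1) / (r * (r + p))) * y t) *: v).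
  apply: continuous_addZ; last exact: continuous_lin.
  apply: continuous_addZ; [exact: cst_continuous | exact: continuous_lin].
apply/funext => t; rewrite /far_vertex /pt addrA; congr (_ + _ *: _ + _ *: _);
  rewrite /outer; ring.
Qed.

Lemma far_vertex_face p r O A C B x y : corner p r O A C B -> admissible p r x y ->
  let A' := O + x *: (A - O) in let B' := O + y *: (B - O) in
  let C' := far_vertex p r O (A - O) (B - O) x y in
  convex_quad O A' C' B' /\ quad_area O A' C' B' = quad_area O A C B.
Proof.
move=> cor adm A' B' C'; have [p0 r0 g0 CE] := cor; have [x0 y0 _ _ co] := adm.
have A'E : A' = pt O (A - O) (B - O) x 0 by rewrite /pt scale0r addr0.
have B'E : B' = pt O (A - O) (B - O) 0 y by rewrite /pt scale0r add0r.
have l0 : 0 < outer p r x y by apply: outer_gt0.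
have k0 : 0 < outer r p y x by apply: outer_gt0 => //; exact: admissibleC.
have c0 := fratio_gt0 p0 r0; have e0 := fratio_gt0 r0 p0.
have key : fratio p r * outer p r x y * y + fratio r p * outer r p y x * x = p * r + 1.
  transitivity ((p * r + 1) / (p + r) ^+ 2 * ((r * x + p * y) ^+ 2 - (x - y) ^+ 2)).
    rewrite /fratio /outer [r + p]addrC [r * p]mulrC.
    by field; rewrite !gt_eqF ?addr_gt0.
  by rewrite co; field; rewrite gt_eqF ?addr_gt0.
(* The quantity equals p r times the product of the outer factors, so convexity follows from their
   positivity. *)
have pos : 0 < fratio p r * outer p r x y * y + fratio r p * outer r p y x * x - x * y.
  have -> : fratio p r * outer p r x y * y + fratio r p * outer r p y x * x - x * y =
    p * r * (outer p r x y * outer r p y x).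
    rewrite /fratio /outer [r + p]addrC [r * p]mulrC.
    by field; rewrite !gt_eqF ?addr_gt0.
  exact: mulr_gt0 (mulr_gt0 p0 r0) (mulr_gt0 l0 k0).
have cl0 := mulr_gt0 c0 l0; have ek0 := mulr_gt0 e0 k0.
have C'E : C' = pt O (A - O) (B - O) (fratio p r * outer p r x y)
  (fratio r p * outer r p y x) by [].
have [u uE] : exists u, u = A - O by exists (A - O).
have [v vE] : exists v, v = B - O by exists (B - O).
have AE : A = pt O u v 1 0 by rewrite uE pt10.
have BE : B = pt O u v 0 1 by rewrite vE pt01.
rewrite -uE -vE in A'E B'E C'E CE g0.
rewrite A'E B'E C'E AE BE CE -(pt00 O u v).
have -> : pt (pt O u v 0 0) u v = pt O u v by rewrite pt00.
split; first by apply: convex_quad_pt.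
by rewrite !quad_area_pt // key !mulr1 fratioD.
Qed.

End Plane.

(** * Nets *)

Local Notation i0 := (ord0 : 'I_3).
Local Notation i1 := (inord 1 : 'I_3).
Local Notation i2 := (ord_max : 'I_3).

Lemma lo0 : lo (ord0 : 'I_2) = i0. Proof. exact: val_inj. Qed.
Lemma hi0 : hi (ord0 : 'I_2) = i1. Proof. by apply: val_inj; rewrite /= inordK. Qed.
Lemma lo1 : lo (ord_max : 'I_2) = i1. Proof. by apply: val_inj; rewrite /= inordK. Qed.
Lemma hi1 : hi (ord_max : 'I_2) = i2. Proof. exact: val_inj. Qed.
Definition lohi := (lo0, hi0, lo1, hi1).

Lemma forall_I2 (Q : 'I_2 -> Prop) : (forall i, Q i) <-> Q ord0 /\ Q ord_max.
Proof.
split=> [H|[H0 H1] [[|[|//]] lt_i]]; first by split.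
  by have <- : ord0 = Ordinal lt_i by apply: val_inj.
by have <- : ord_max = Ordinal lt_i by apply: val_inj.
Qed.

Lemma forall_I3 (Q : 'I_3 -> Prop) : (forall i, Q i) <-> Q i0 /\ Q i1 /\ Q i2.
Proof.
split=> [H|[H0 [H1 H2]] [[|[|[|//]]] lt_i]]; first by split.
- by have <- : ord0 = Ordinal lt_i by apply: val_inj.
- by have <- : inord 1 = Ordinal lt_i by apply: val_inj; rewrite /= inordK.
- by have <- : ord_max = Ordinal lt_i by apply: val_inj.
Qed.

Section Net.
Variables (R : realType) (d : nat).
Local Notation point := 'rV[R]_d.
Local Notation points := ('I_3 -> 'I_3 -> point).
Implicit Types P : points.

(** Every face is read from the centre, in cyclic order, so that the second arm of a face is the
    first arm of the next. *)
Lemma net_corners P : @net R d 2 2 P <->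
  [/\ convex_quad (P i1 i1) (P i2 i1) (P i2 i2) (P i1 i2),
      convex_quad (P i1 i1) (P i1 i2) (P i0 i2) (P i0 i1),
      convex_quad (P i1 i1) (P i0 i1) (P i0 i0) (P i1 i0) &
      convex_quad (P i1 i1) (P i1 i0) (P i2 i0) (P i2 i1)].
Proof.
rewrite /net forall_I2 !forall_I2 !lohi; split=> [[[f00 f01] [f10 f11]]|[f1 f2 f3 f4]].
  by split=> //; [exact: convex_quad_rot f01 |
    exact: convex_quad_rot (convex_quad_rot f00) |
    exact: convex_quad_rot (convex_quad_rot (convex_quad_rot f10))].
have g2 := convex_quad_rot (convex_quad_rot (convex_quad_rot f2)).
have g3 := convex_quad_rot (convex_quad_rot f3).
by split; split=> //; exact: convex_quad_rot f4.
Qed.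

Lemma face_area_corners P P' : @net R d 2 2 P -> @net R d 2 2 P' ->
  (forall i j : 'I_2, face_area P i j = face_area P' i j) <->
  [/\ quad_area (P i1 i1) (P i2 i1) (P i2 i2) (P i1 i2) =
        quad_area (P' i1 i1) (P' i2 i1) (P' i2 i2) (P' i1 i2),
      quad_area (P i1 i1) (P i1 i2) (P i0 i2) (P i0 i1) =
        quad_area (P' i1 i1) (P' i1 i2) (P' i0 i2) (P' i0 i1),
      quad_area (P i1 i1) (P i0 i1) (P i0 i0) (P i1 i0) =
        quad_area (P' i1 i1) (P' i0 i1) (P' i0 i0) (P' i1 i0) &
      quad_area (P i1 i1) (P i1 i0) (P i2 i0) (P i2 i1) =
        quad_area (P' i1 i1) (P' i1 i0) (P' i2 i0) (P' i2 i1)].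
Proof.
move=> /net_corners[c1 c2 c3 c4] /net_corners[c1' c2' c3' c4'].
have r2 A B C D : convex_quad (A : point) B C D -> quad_area C D A B = quad_area A B C D.
  by move=> c; rewrite (quad_area_rot (convex_quad_rot c)) quad_area_rot.
have r3 A B C D : convex_quad (A : point) B C D -> quad_area D A B C = quad_area A B C D.
  by move=> c; rewrite (quad_area_rot (convex_quad_rot (convex_quad_rot c))) r2.
rewrite forall_I2 !forall_I2 /face_area !lohi.
rewrite (r2 _ _ _ _ c3) (r2 _ _ _ _ c3') (r3 _ _ _ _ c2) (r3 _ _ _ _ c2').
rewrite (quad_area_rot c4) (quad_area_rot c4').
by split=> [[[? ?] [? ?]]|[? ? ? ?]].
Qed.

(** [parallel] only excludes the factor 0. For v != 0 the factor varies continuously and is 1 at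
    [t0], so by the intermediate value theorem it stays positive. *)
Lemma parallel_continuous (e : R -> point) v (a b t0 : R) :
  {within `[a, b], continuous e} -> a <= t0 <= b -> e t0 = v ->
  (forall t, a <= t <= b -> parallel v (e t)) ->
  forall t, a <= t <= b -> exists2 k, 0 < k & e t = k *: v.
Proof.
move=> ce t0ab et0 par t tab.
have [v0|v0] := eqVneq v 0.
  by exists 1 => //; have [k _ ->] := par t tab; rewrite v0 !scaler0.
have [i vi] : exists i, v 0 i != 0.
  apply/existsP; apply: contraNT v0; rewrite negb_exists => /forallP H.
  by apply/eqP/rowP => i; rewrite mxE; apply/eqP; have := H i; rewrite negbK.
pose g s := e s 0 i / v 0 i.
have gE s : a <= s <= b -> g s != 0 /\ e s = g s *: v.
  by move=> /par[k k0 es]; rewrite /g es mxE mulfK.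
have [gt0 gtE] := gE t tab; exists (g t) => //.
have cg : {within `[a, b], continuous g}.
  have ch : continuous (fun x : point => x 0 i * (v 0 i)^-1).
    move=> x; have ci : {for x, continuous (fun x : point => x 0 i)}.
      exact: (@coord_continuous R 1 d 0 i x).
    by apply: (continuousM ci); apply: cst_continuous.
  by move=> s; exact: (continuous_comp (ce s) (ch (e s))).
have g1 : g t0 = 1 by rewrite /g et0 divff.
rewrite lt_neqAle eq_sym gt0 /= leNgt; apply/negP => g_lt0.
have [c cab gc0] : exists2 c, a <= c <= b & g c = 0.
  have [/andP[at0 t0b] /andP[a_t tb]] := (t0ab, tab).
  have sub x y : a <= x -> y <= b -> {within `[x, y], continuous g}.
    move=> ax yb; apply: continuous_subspaceW cg => z /=; rewrite !in_itv /=.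
    by move=> /andP[xz zy]; rewrite (le_trans ax xz) (le_trans zy yb).
  have [le|/ltW le] := leP t t0.
    have [|c] := @IVT R g t t0 0 le (sub _ _ a_t t0b).
      by rewrite ge_min le_max g1 ler01 (ltW g_lt0) orbT.
    rewrite in_itv /= => /andP[tc ct0] gc; exists c => //.
    by rewrite (le_trans a_t tc) (le_trans ct0 t0b).
  have [|c] := @IVT R g t0 t 0 le (sub _ _ at0 tb).
    by rewrite ge_min le_max g1 ler01 (ltW g_lt0) orbT.
  rewrite in_itv /= => /andP[tc ct0] gc; exists c => //.
  by rewrite (le_trans at0 tc) (le_trans ct0 tb).
by have [] := gE c cab; rewrite gc0 eqxx.
Qed.

Section Shape.
Variables (P : points) (p1 r1 p2 r2 p3 r3 p4 r4 : R).
Local Notation O := (P i1 i1).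
Local Notation A1 := (P i2 i1).
Local Notation A2 := (P i1 i2).
Local Notation A3 := (P i0 i1).
Local Notation A4 := (P i1 i0).
Hypothesis cor1 : corner p1 r1 O A1 (P i2 i2) A2.
Hypothesis cor2 : corner p2 r2 O A2 (P i0 i2) A3.
Hypothesis cor3 : corner p3 r3 O A3 (P i0 i0) A4.
Hypothesis cor4 : corner p4 r4 O A4 (P i2 i0) A1.

Definition admissible4 x1 x2 x3 x4 :=
  [/\ admissible p1 r1 x1 x2, admissible p2 r2 x2 x3, admissible p3 r3 x3 x4 &
      admissible p4 r4 x4 x1].

(* The net with centre Q parallel to P in which the edges of P at its centre are
   scaled by x1, x2, x3, x4 (in cyclic order). *)
Definition shape (Q : point) (x1 x2 x3 x4 : R) : points := fun i j =>
  match val i, val j with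
  | 0, 0 => far_vertex p3 r3 Q (A3 - O) (A4 - O) x3 x4
  | 0, 1 => Q + x3 *: (A3 - O)
  | 0, _ => far_vertex p2 r2 Q (A2 - O) (A3 - O) x2 x3
  | 1, 0 => Q + x4 *: (A4 - O)
  | 1, 1 => Q
  | 1, _ => Q + x2 *: (A2 - O)
  | _, 0 => far_vertex p4 r4 Q (A4 - O) (A1 - O) x4 x1
  | _, 1 => Q + x1 *: (A1 - O)
  | _, _ => far_vertex p1 r1 Q (A1 - O) (A2 - O) x1 x2
  end.

Lemma eq_shape (N : points) Q x1 x2 x3 x4 :
  (forall i j, N i j = shape Q x1 x2 x3 x4 i j) <->
  [/\ [/\ N i2 i2 = far_vertex p1 r1 Q (A1 - O) (A2 - O) x1 x2,
      N i0 i2 = far_vertex p2 r2 Q (A2 - O) (A3 - O) x2 x3,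
      N i0 i0 = far_vertex p3 r3 Q (A3 - O) (A4 - O) x3 x4 &
      N i2 i0 = far_vertex p4 r4 Q (A4 - O) (A1 - O) x4 x1],
      [/\ N i2 i1 = Q + x1 *: (A1 - O), N i1 i2 = Q + x2 *: (A2 - O),
      N i0 i1 = Q + x3 *: (A3 - O) & N i1 i0 = Q + x4 *: (A4 - O)] & N i1 i1 = Q].
Proof.
have i1E : val i1 = 1%N by rewrite /= inordK.
rewrite forall_I3 !forall_I3 /shape i1E /=.
by split=> [[[? [? ?]] [[? [? ?]] [? [? ?]]]]|[[? ? ? ?] [? ? ? ?] ?]].
Qed.

Lemma parallel_shape (N : points) : @net R d 2 2 P -> @net R d 2 2 N ->
  (forall i j : 'I_2, face_area N i j = face_area P i j) ->
  (forall (i : 'I_2) j, exists2 k, 0 < k & N (hi i) j - N (lo i) j =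
    k *: (P (hi i) j - P (lo i) j)) ->
  (forall i (j : 'I_2), exists2 k, 0 < k & N i (hi j) - N i (lo j) =
    k *: (P i (hi j) - P i (lo j))) ->
  exists x1 x2 x3 x4, admissible4 x1 x2 x3 x4 /\
    forall i j, N i j = shape (N i1 i1) x1 x2 x3 x4 i j.
Proof.
move=> nP nN /(face_area_corners nN nP)[a1 a2 a3 a4];
  rewrite !forall_I2 !forall_I3 !forall_I2 !lohi.
move=> [[[k1 k10 e1] [[x3 x30 e2] [k3 k30 e3]]] [[k4 k40 e4] [[x1 x10 e5] [k6 k60 e6]]]].
move=> [[[l1 l10 f1] [l2 l20 f2]] [[[x4 x40 f3] [x2 x20 f4]] [[l5 l50 f5] [l6 l60 f6]]]].
have neg (x y z w : point) (k : R) : x - y = k *: (z - w) -> y - x = k *: (w - z).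
  by move=> e; rewrite -opprB e -scalerN opprB.
have [adm1 c1] := parallel_corner cor1 x10 x20 l60 k60 e5 f4 f6 e6 a1.
have [adm2 c2] := parallel_corner cor2 x20 x30 k30 l20 f4 (neg _ _ _ _ _ e2)
  (neg _ _ _ _ _ e3) f2 a2.
have [adm3 c3] := parallel_corner cor3 x30 x40 l10 k10 (neg _ _ _ _ _ e2)
  (neg _ _ _ _ _ f3)
  (neg _ _ _ _ _ f1) (neg _ _ _ _ _ e1) a3.
have [adm4 c4] := parallel_corner cor4 x40 x10 k40 l50 (neg _ _ _ _ _ f3) e5 e4
  (neg _ _ _ _ _ f5) a4.
exists x1, x2, x3, x4; split=> //; apply/eq_shape; split=> //.
by split; rewrite addrC -?e5 -?f4 -?(neg _ _ _ _ _ e2) -?(neg _ _ _ _ _ f3) subrK.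
Qed.

(** The centre of a net in the family may move; by this lemma non-congruent members must differ in
    one of the four factors. *)
Lemma shape_translate Q Q' x1 x2 x3 x4 :
  congruent_nets (shape Q x1 x2 x3 x4) (shape Q' x1 x2 x3 x4).
Proof.
exists (fun y => y + (Q' - Q)) => [x y|i j].
  rewrite /Defs.edist; have -> : x + (Q' - Q) - (y + (Q' - Q)) = x - y => //.
  by rewrite opprD addrACA subrr addr0.
have e w : Q + w + (Q' - Q) = Q' + w by rewrite addrAC [Q + _]addrC subrK.
by rewrite /shape /far_vertex /pt;
  case: (val i) (val j) => [|[|?]] [|[|?]]; rewrite ?e // addrC subrK.
Qed.

Hypothesis nP : @net R d 2 2 P.

Lemma deformable_rigid : @deformable R d 2 2 P ->
  [\/ [/\ r1 = p2, r2 = p3, r3 = p4 & r4 = p1],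
      [/\ p1 = r2, r1 = p2, p3 = r4 & r3 = p4] |
      [/\ p2 = r3, r2 = p3, p4 = r1 & r4 = p1]].
Proof.
move=> [a [b [t0 [N [[ab t0ab Nt0] [cont H ncong]]]]]].
have edge (x y z w : 'I_3) : (forall t, a <= t <= b ->
  parallel (P x y - P z w) (N t x y - N t z w)) ->
    forall t, a <= t <= b -> exists2 k, 0 < k & N t x y - N t z w = k *: (P x y - P z w).
  apply: (parallel_continuous (e := fun t => N t x y - N t z w) (t0 := t0)) => //;
    last by rewrite !Nt0.
  by move=> s; exact: (continuousB (cont x y s) (cont z w s)).
have shapeN t : a <= t <= b -> exists x1 x2 x3 x4,
    admissible4 x1 x2 x3 x4 /\
    N t = shape (N t i1 i1) x1 x2 x3 x4.
  move=> tab; have [nN _ aN] := H t tab.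
  have [||x1 [x2 [x3 [x4 [adm NE]]]]] := parallel_shape nP nN aN.
  - by move=> i j; apply: edge => // s /H[_ [par _] _]; exact: par.
  - by move=> i j; apply: edge => // s /H[_ [_ par] _]; exact: par.
  - by exists x1, x2, x3, x4; split=> //; apply/funext => i; apply/funext => j.
(* Infinitely many distinct parameters, starting at t 0 = b; the shift by one avoids the default
   value of division by 0. *)
pose t n := a + (b - a) / n.+1%:R.
have tab n : a <= t n <= b.
  have n0 : 0 < n.+1%:R :> R by rewrite ltr0n.
  have ba : 0 < b - a by rewrite subr_gt0.
  apply/andP; split; first by rewrite lerDl ltW ?divr_gt0.
  by rewrite /t -lerBrDl ler_pdivrMr // ler_peMr ?ler1n // ltW.
have tinj : injective t.
  move=> m n /addrI /(mulfI (_ : b - a != 0)); rewrite subr_eq0 gt_eqF // => /(_ isT).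
  by move=> /invr_inj /eqP; rewrite eqr_nat => /eqP[].
have /choice[x1 /choice[x2 /choice[x3 /choice[x4 X]]]] := fun n => shapeN (t n) (tab n).
have [p10 r10 _ _] := cor1; have [p20 r20 _ _] := cor2.
have [p30 r30 _ _] := cor3; have [p40 r40 _ _] := cor4.
apply: (@infinite_family_cases R p1 r1 p2 r2 p3 r3 p4 r4 x1 x2 x3 x4) => //;
  try by move=> n; have [[]] := X n.
(* Equal values of x1 propagate through the conics to x2, x3 and x4, and the two nets are then
   translates of each other. *)
move=> m n E1; have [[am1 am2 am3 am4] Nm] := X m; have [[an1 an2 an3 an4] Nn] := X n.
rewrite E1 in am1 am4 Nm.
have E2 := admissible_inj am1 an1; rewrite E2 in am1 am2 Nm.
have E3 := admissible_inj am2 an2; rewrite E3 in am2 am3 Nm.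
have E4 := admissible_inj am3 an3; rewrite E4 in am3 am4 Nm.
apply/eqP; apply: contraT => mn; exfalso.
apply: (ncong (t m) (t n) (tab m) (tab n)); first by apply: contra mn => /eqP/tinj->.
by rewrite Nm Nn; exact: shape_translate.
Qed.

Lemma adjacent_faces_left (S : point -> point -> point -> point -> point -> point ->
  Prop) :
  (forall j : 'I_2, adjacent_faces S P j) <->
  S A4 O A3 (P i0 i0) A1 (P i2 i0) /\ S O A2 (P i0 i2) A3 (P i2 i2) A1.
Proof. by rewrite forall_I2 /adjacent_faces !lohi. Qed.

Lemma adjacent_faces_right (S : point -> point -> point -> point -> point -> point ->
  Prop) :
  (forall j : 'I_2, adjacent_faces S (transposed P) j) <->
  S A3 O A4 (P i0 i0) A2 (P i0 i2) /\ S O A1 (P i2 i0) A4 (P i2 i2) A2.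
Proof. by rewrite forall_I2 /adjacent_faces /transposed !lohi. Qed.

Lemma affine_symmetric_pairsE : affine_symmetric_pairs P <->
  [/\ p1 = r2, r1 = p2, p3 = r4 & r3 = p4] \/ [/\ p2 = r3, r2 = p3, p4 = r1 & r4 = p1].
Proof.
rewrite /affine_symmetric_pairs adjacent_faces_left adjacent_faces_right.
rewrite (affine_symmetricC A4) (affine_symmetricC A3).
rewrite (affine_symmetric_corner (cornerC cor3) cor4)
  (affine_symmetric_corner cor2 (cornerC cor1)).
rewrite (affine_symmetric_corner cor3 (cornerC cor2))
  (affine_symmetric_corner (cornerC cor4) cor1).
by split=> [[[[? ?] [? ?]]|[[? ?] [? ?]]]|[[? ? ? ?]|[? ? ? ?]]];
  [left|right|left|right]; split.
Qed.

Lemma equal_opposite_ratiosE : equal_opposite_ratios P <->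
  [/\ r1 = p2, r2 = p3, r3 = p4 & r4 = p1].
Proof.
rewrite /equal_opposite_ratios adjacent_faces_left adjacent_faces_right.
rewrite /same_opposite_ratio (opposite_ratio_corner (cornerC cor3)).2
  (opposite_ratio_corner cor4).2.
rewrite (opposite_ratio_corner cor2).1 (opposite_ratio_corner (cornerC cor1)).1.
rewrite (opposite_ratio_corner cor3).2 (opposite_ratio_corner (cornerC cor2)).2.
rewrite (opposite_ratio_corner (cornerC cor4)).1 (opposite_ratio_corner cor1).1.
have inv (p q : R) : 0 < p -> 0 < q -> p ^- 2 = q ^- 2 -> p = q.
  by move=> p0 q0 /invr_inj/eqP; rewrite eqrXn2 ?ltW // => /eqP.
have [p10 r10 _ _] := cor1; have [p20 r20 _ _] := cor2.
have [p30 r30 _ _] := cor3; have [p40 r40 _ _] := cor4.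
split=> [[[e1 e2] [e3 e4]]|[-> -> -> ->]]; last by do !split.
by split; [rewrite (inv _ _ p20 r10 e2) | rewrite (inv _ _ p30 r20 e3) |
  exact: inv e1 | exact: inv e4].
Qed.

Lemma shape_one : forall i j, P i j = shape O 1 1 1 1 i j.
Proof.
have far p r (X A C B : point) : corner p r X A C B ->
  C = far_vertex p r X (A - X) (B - X) 1 1.
  case=> p0 r0 _ {1}->; rewrite /far_vertex; congr (pt _ _ _ _ _).
    by rewrite [LHS](_ : _ = fratio p r * 1) ?mulr1 // /outer; field;
      rewrite !gt_eqF ?addr_gt0.
  by rewrite [LHS](_ : _ = fratio r p * 1) ?mulr1 // /outer; field;
    rewrite !gt_eqF ?addr_gt0.
apply/eq_shape; split; first by split; apply: far.
  by split; rewrite scale1r addrC subrK.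
by [].
Qed.

Lemma deformable_curve (b : R) (x2 x3 x4 : R -> R) : 1 < b ->
  (forall t, 1 <= t <= b -> admissible4 t (x2 t) (x3 t) (x4 t)) ->
  {within `[1, b], continuous x2} -> {within `[1, b], continuous x3} ->
    {within `[1, b], continuous x4} ->
  x2 1 = 1 -> x3 1 = 1 -> x4 1 = 1 -> @deformable R d 2 2 P.
Proof.
move=> b1 adm cx2 cx3 cx4 e2 e3 e4.
pose N t := shape O t (x2 t) (x3 t) (x4 t).
have NE t := (eq_shape (N t) O t (x2 t) (x3 t) (x4 t)).1 (fun i j => erefl).
(* The family is parametrized by x1 itself; the given net is its endpoint t = 1, where all factors
   are 1. *)
exists 1, b, 1, N; split; first by rewrite lexx ltW //; split=> // i j;
  rewrite /N e2 e3 e4 -shape_one.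
split.
- have ctr : continuous (fun t : R => N t i1 i1).
    rewrite (_ : (fun t => _) = fun=> O); first exact: cst_continuous.
    by apply/funext => t; have [_ _] := NE t.
  have cx1 : {within `[1, b], continuous (fun t : R => t)}.
    by apply: continuous_subspaceT => t; exact: cvg_id.
  pose sub := subspace `[1%R, b].
  have arm (i j : 'I_3) (x : R -> R) u : (forall t, N t i j = O + x t *: u) ->
      {within `[1, b], continuous x} -> {within `[1, b], continuous (fun t => N t i j)}.
    move=> e cx s; rewrite (_ : (fun t => _) = fun t => O + x t *: u); last exact/funext.
    by apply: (@continuous_addZ R d sub (fun=> O) x s u);
      [exact: cst_continuous | exact: cx].
  have far (i j : 'I_3) (x y : R -> R) p r u v :
      (forall t, N t i j = far_vertex p r O u v (x t) (y t)) ->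
      {within `[1, b], continuous x} -> {within `[1, b], continuous y} ->
      {within `[1, b], continuous (fun t => N t i j)}.
    move=> e cx cy s; rewrite (_ : (fun t => _) = fun t =>
      far_vertex p r O u v (x t) (y t)); last exact/funext.
    by apply: (@continuous_far R d sub x y s p r O u v); [exact: cx | exact: cy].
  apply/forall_I3; split; [|split]; apply/forall_I3; (split; [|split]).
  + by apply: far cx3 cx4 => t; have [[_ _ e _] _ _] := NE t; exact: e.
  + by apply: arm cx3 => t; have [_ [_ _ e _] _] := NE t; exact: e.
  + by apply: far cx2 cx3 => t; have [[_ e _ _] _ _] := NE t; exact: e.
  + by apply: arm cx4 => t; have [_ [_ _ _ e] _] := NE t; exact: e.
  + exact: continuous_subspaceT.
  + by apply: arm cx2 => t; have [_ [_ e _ _] _] := NE t; exact: e.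
  + by apply: far cx4 cx1 => t; have [[_ _ _ e] _ _] := NE t; exact: e.
  + by apply: arm cx1 => t; have [_ [e _ _ _] _] := NE t; exact: e.
  + by apply: far cx1 cx2 => t; have [[e _ _ _] _ _] := NE t; exact: e.
- move=> t tb; have [a1 a2 a3 a4] := adm t tb.
  have [[c1 c2 c3 c4] [f1 f2 f3 f4] NO] := NE t.
  have nN : @net R d 2 2 (N t).
    rewrite net_corners NO c1 c2 c3 c4 f1 f2 f3 f4; split.
    + exact: (far_vertex_face cor1 a1).1.
    + exact: (far_vertex_face cor2 a2).1.
    + exact: (far_vertex_face cor3 a3).1.
    + exact: (far_vertex_face cor4 a4).1.
  split=> //; last first.
    apply/(face_area_corners nN nP); rewrite NO c1 c2 c3 c4 f1 f2 f3 f4; split.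
    + exact: (far_vertex_face cor1 a1).2.
    + exact: (far_vertex_face cor2 a2).2.
    + exact: (far_vertex_face cor3 a3).2.
    + exact: (far_vertex_face cor4 a4).2.
  have parE (x y x' y' : point) k : 0 < k -> x' - y' = k *: (x - y) ->
    parallel (x - y) (x' - y').
    by move=> k0 e; exists k => //; rewrite gt_eqF.
  have parN (x y x' y' : point) k : 0 < k -> x' - y' = k *: (x - y) ->
    parallel (y - x) (y' - x').
    by move=> k0 e; exists k; rewrite ?gt_eqF // -opprB e -scalerN opprB.
  have armB (y : R) (u : point) : (O + y *: u) - O = y *: u by rewrite addrC addKr.
  have out p r x y (X A B C : point) : corner p r X A B C -> admissible p r x y ->
      0 < outer p r x y /\ 0 < outer r p y x.
    by case=> p0 r0 _ _ adm'; split; apply: outer_gt0 => //; exact: admissibleC.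
  have [w1 w1'] := out _ _ _ _ _ _ _ _ cor1 a1;
    have [w2 w2'] := out _ _ _ _ _ _ _ _ cor2 a2.
  have [w3 w3'] := out _ _ _ _ _ _ _ _ cor3 a3;
    have [w4 w4'] := out _ _ _ _ _ _ _ _ cor4 a4.
  have [x10 x20 _ _ _] := a1; have [x30 x40 _ _ _] := a3.
  rewrite /parallel_nets !forall_I2 !forall_I3 !forall_I2 !lohi NO c1 c2 c3 c4 f1 f2
    f3 f4.
  do !split.
  - exact: parN w3 (far_vertexBr _ _ cor3).
  - exact: parN x30 (armB _ _).
  - exact: parN w2' (far_vertexBl cor2 _ _).
  - exact: parE w4' (far_vertexBl cor4 _ _).
  - exact: parE x10 (armB _ _).
  - exact: parE w1 (far_vertexBr _ _ cor1).
  - exact: parN w3' (far_vertexBl cor3 _ _).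
  - exact: parE w2 (far_vertexBr _ _ cor2).
  - exact: parN x40 (armB _ _).
  - exact: parE x20 (armB _ _).
  - exact: parN w4 (far_vertexBr _ _ cor4).
  - exact: parE w1' (far_vertexBl cor1 _ _).
(* A congruence preserves the length of the first arm, which is t times a fixed positive number. *)
- move=> s t sb tb st [f isof fE].
  have [_ [Es _ _ _] NsO] := NE s; have [_ [Et _ _ _] NtO] := NE t.
  have := isof (N s i2 i1) (N s i1 i1); rewrite !fE /Defs.edist Es Et NsO NtO.
  have armB (y : R) (u : point) : (O + y *: u) - O = y *: u by rewrite addrC addKr.
  have nZ (y : R) (u : point) : Num.sqrt (dotv (y *: u) (y *: u)) =
    `|y| * Num.sqrt (dotv u u).
    by rewrite dotvZl dotvZr mulrA -expr2 sqrtrM ?sqr_ge0 // sqrtr_sqr.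
  rewrite !armB !nZ.
  have [_ _ g0 _] := cor1.
  have u0 : Num.sqrt (dotv (A1 - O) (A1 - O)) != 0.
    rewrite gt_eqF // sqrtr_gt0 lt_def dotv_ge0 dotv_eq0 andbT.
    by apply: contraTneq g0 => ->; rewrite gram0v ltxx.
  move=> /(mulIf u0); have [/andP[s1 _] /andP[t1 _]] := (sb, tb).
  rewrite !ger0_norm ?(le_trans ler01) // => ts.
  by rewrite ts eqxx in st.
Qed.

Lemma deformable_match : r1 = p2 -> r3 = p4 ->
  (r4 = p1 /\ r2 = p3) \/ (p1 = r2 /\ p3 = r4) -> @deformable R d 2 2 P.
Proof.
move=> e1 e3 e.
have [p10 r10 _ _] := cor1; have [p20 r20 _ _] := cor2.
have [p30 r30 _ _] := cor3; have [p40 r40 _ _] := cor4.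
pose x2 := branch p1 r1; pose x3 := branch p1 (- r2); pose x4 := branch r4 p4.
have C t : 1 <= t -> [/\ conic p1 r1 t (x2 t), conic p2 r2 (x2 t) (x3 t),
    conic p3 r3 (x3 t) (x4 t) & conic p4 r4 (x4 t) t].
  move=> t1; split.
  - exact: branch_conic.
  - by rewrite -e1; exact: branch_conic2.
  (* This face closes the cycle. Either r4 = p1, and x3 and x4 are given by the same c and h, or x3
     = t, and the conic is that of face 4 read backwards. *)
  - rewrite e3 /x3 /x4; case: e => [[-> ->]|[-> ->]]; last by rewrite branch_id;
    exact: branch_conic.
    by apply: conicC; have := @branch_conic2 R p1 p4 p3 t p10 t1.
  - by apply: conicC; exact: branch_conic.
have cont (x : R) : 0 < x -> [/\ {for x, continuous x2},
  {for x, continuous x3} & {for x, continuous x4}].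
  by move=> x0; split; exact: branch_continuous.
have [c2 c3 c4] := cont 1 ltr01.
have cid : {for (1 : R), continuous (fun t : R => t)} by exact: cvg_id.
have [e21 e31 e41] : [/\ x2 1 = 1, x3 1 = 1 & x4 1 = 1] by split; exact: branch1.
have N1 := near_admissible p10 r10 cid c2 erefl e21.
have N2 := near_admissible p20 r20 c2 c3 e21 e31.
have N3 := near_admissible p30 r30 c3 c4 e31 e41.
have N4 := near_admissible p40 r40 c4 cid e41 erefl.
(* A common radius around 1 for the open conditions of all four faces; the family uses half of
   it. *)
have [k /= k0 kball] := (nbhs_ballP _ _).1 (filterI (filterI N1 N2) (filterI N3 N4)).
have wi (f : R -> R) : (forall x : R, 0 < x -> {for x, continuous f}) ->
    {within `[1, 1 + k / 2], continuous (f : R -> R)}.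
  move=> cf; apply: continuous_in_subspaceT => x; rewrite inE /= in_itv /= => /andP[x1 _].
  by apply: cf; exact: lt_le_trans x1.
apply: (deformable_curve (b := 1 + k / 2) (x2 := x2) (x3 := x3) (x4 := x4)) => //.
- by rewrite ltrDl divr_gt0.
- move=> t /andP[t1 tb]; have [C1 C2 C3 C4] := C t t1.
  have [|[a1 a2] [a3 a4]] := kball t.
    rewrite /ball /= distrC ger0_norm ?subr_ge0 // ltrBlDl (le_lt_trans tb) // ltrD2l.
    by rewrite ltr_pdivrMr // ltr_pMr // ltr1n.
  by split; [exact: a1 | exact: a2 | exact: a3 | exact: a4].
- by apply: wi => x /cont[].
- by apply: wi => x /cont[].
- by apply: wi => x /cont[].
Qed.
End Shape.

(** * Exchanging the two index directions *)

Lemma net_transposed P : @net R d 2 2 P -> @net R d 2 2 (transposed P).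
Proof. by move=> nP i j; exact: convex_quad_rev (nP j i). Qed.

Lemma deformable_transposed P : @deformable R d 2 2 P ->
  @deformable R d 2 2 (transposed P).
Proof.
move=> [a [b [t0 [N [[ab t0ab Nt0] [cont H nc]]]]]].
exists a, b, t0, (fun t => transposed (N t)); split; first by split=> // i j; exact: Nt0.
split=> [i j|t tab|s t sab tab st [f isof fE]]; first exact: cont.
  have [nN [par1 par2] area] := H t tab.
  split; [exact: net_transposed | by split=> i j; [exact: par2 | exact: par1] |].
  move=> i j; apply: etrans (quad_area_rev _ _ _ _) _.
  exact: etrans (area j i) (esym (quad_area_rev _ _ _ _)).
by apply: (nc s t sab tab st); exists f => // i j; exact: fE.
Qed.

End Net.

Theorem theorem2p2 (R : realType) (d : nat) (P : 'I_3 -> 'I_3 -> 'rV[R]_d)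
    (hP : @net R d 2 2 P) :
  @deformable R d 2 2 P <->
  affine_symmetric_pairs P \/ equal_opposite_ratios P.
Proof.
have [f1 f2 f3 f4] := (net_corners P).1 hP.
have [p1 [r1 cor1]] := convex_quad_corner f1.
have [p2 [r2 cor2]] := convex_quad_corner f2.
have [p3 [r3 cor3]] := convex_quad_corner f3.
have [p4 [r4 cor4]] := convex_quad_corner f4.
rewrite (affine_symmetric_pairsE cor1 cor2 cor3 cor4)
  (equal_opposite_ratiosE cor1 cor2 cor3 cor4).
split=> [/(deformable_rigid cor1 cor2 cor3 cor4 hP)[]|].
- by right.
- by left; left.
- by left; right.
case=> [[[e1 e2 e3 e4]|[e1 e2 e3 e4]]|[e1 e2 e3 e4]].
- by apply: (deformable_match cor1 cor2 cor3 cor4) => //; right.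
(* Transposition swaps arm 1 with 2 and arm 3 with 4, so pairs of faces symmetric across edges 1 and
   3 become pairs symmetric across edges 2 and 4. *)
- apply: (@deformable_transposed R d (transposed P)).
  have nT := net_transposed hP.
  by apply: (deformable_match (P := transposed P) (cornerC cor1) (cornerC cor4)
    (cornerC cor3) (cornerC cor2)) => //; right.
- by apply: (deformable_match cor1 cor2 cor3 cor4) => //; left.
Qed.
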